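(* For most $d$-norms $\|\cdot\|$ the following holds: for every connected graph $G=(V,E)$ and every finite set $P\subset\mathbb{R}^d$, $$\big|f_{\|\cdot\|,G}(P^V)\big|\gg\left(\frac{|P|}{(\log|P|)^2}\right)^{|V|-1},$$ where the implicit constant depends only on $G$ and $\|\cdot\|$.
   Context: A $d$-norm is a norm on $\mathbb{R}^d$. Let $B_d$ be the space of all $d$-norms equipped with the Hausdorff metric (on their unit balls); it is a Baire space. A property holds for ''most $d$-norms'' if it holds for all $d$-norms outside a meagre subset of $B_d$. For a graph $G=(V,E)$, $f_{\|\cdot\|,G}:(\mathbb{R}^d)^V\to\mathbb{R}^E$, $p\mapsto(\|p(v)-p(w)\|)_{vw\in E}$. $X\gg Y$ means there is $c>0$ independent of $P$ with $X\ge cY$ for all sufficiently large $|P|$. *)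

(* Defs.v *)
From HB Require Import structures.
From mathcomp Require Import all_boot all_order all_algebra finmap.
From mathcomp Require Import all_classical all_reals all_analysis ring.

Set Implicit Arguments.
Unset Strict Implicit.
Unset Printing Implicit Defensive.

Import Order.TTheory GRing.Theory Num.Theory.
Import numFieldTopology.Exports numFieldNormedType.Exports.

Local Open Scope ring_scope.

Record sgraph := SGraph {
  vertex :> finType;
  adj : rel vertex;
  adj_sym : symmetric adj;
  adj_irrefl : irreflexive adj }.

Definition connected_graph (G : sgraph) : Prop :=
  (0 < #|G|)%N /\ forall v w : G, connect (@adj G) v w.

Definition edge_set (G : sgraph) : {set {set G}} :=
  [set [set v; w]%SET | v in G, w in adj v]%SET.

Definition edge (G : sgraph) : finType := {a : {set G} | a \in edge_set G}.

Fact edge_endpoints (G : sgraph) (a : edge G) :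
  exists vw : G * G, adj vw.1 vw.2 && (val a == [set vw.1; vw.2]%SET).
Proof.
case: a => a /= /finset.imset2P[v w _]; rewrite unfold_in => vw ->.
by exists (v, w); rewrite eqxx andbT; exact: vw.
Qed.

(* An arbitrary ordering of the two ends of an edge; norms being even, it does
   not affect edge lengths, see edge_lengthsE. *)
Definition endpoints (G : sgraph) (a : edge G) : G * G :=
  xchoose (edge_endpoints a).

Record dnorm (R : realType) (d : nat) := DNorm {
  dnorm_fun :> 'rV[R]_d -> R;
  dnorm_triangle : forall x y, dnorm_fun (x + y) <= dnorm_fun x + dnorm_fun y;
  dnormZ : forall (a : R) x, dnorm_fun (a *: x) = `|a| * dnorm_fun x;
  dnorm_eq0 : forall x, dnorm_fun x = 0 -> x = 0 }.

Section dnorm_theory.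
Context {R : realType} {d : nat}.
Implicit Types (N : dnorm R d) (x y : 'rV[R]_d).

Lemma dnorm0 N : N 0 = 0.
Proof. by rewrite -(scale0r 0) dnormZ normr0 mul0r. Qed.

Lemma dnormN N x : N (- x) = N x.
Proof. by rewrite -scaleN1r dnormZ normrN1 mul1r. Qed.

Lemma dnorm_ge0 N x : 0 <= N x.
Proof.
rewrite -(pmulrn_lge0 _ (ltn0Sn 1)) mulr2n -{2}(dnormN N x).
by rewrite -(dnorm0 N) -(subrr x) dnorm_triangle.
Qed.

Lemma dnormB N x y : N (x - y) = N (y - x).
Proof. by rewrite -dnormN opprB. Qed.

End dnorm_theory.

Section edge_lengths.
Context {R : realType} {d : nat}.

Definition edge_lengths (N : dnorm R d) (G : sgraph)
    (p : {ffun G -> 'rV[R]_d}) : {ffun edge G -> R} :=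
  [ffun a => N (p (endpoints a).1 - p (endpoints a).2)].

Lemma edge_lengthsE (N : dnorm R d) (G : sgraph) (p : {ffun G -> 'rV[R]_d})
    (a : edge G) (v w : G) :
  val a = [set v; w]%SET -> edge_lengths N p a = N (p v - p w).
Proof.
move=> avw; rewrite ffunE /endpoints.
move: (xchooseP (edge_endpoints a)).
case: (xchoose _) => x y /= /andP[xy /eqP]; rewrite avw => e.
have xNy : x != y by apply: contraTneq xy => ->; rewrite adj_irrefl.
have /orP[/eqP ?|/eqP ?] : (x == v) || (x == w) by rewrite -finset.in_set2 e set21.
  have /orP[/eqP ?|/eqP ?] : (y == v) || (y == w) by rewrite -finset.in_set2 e set22.
    by move: xNy; subst; rewrite eqxx.
  by subst.
have /orP[/eqP ?|/eqP ?] : (y == v) || (y == w) by rewrite -finset.in_set2 e set22.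
  by subst; rewrite dnormB.
by move: xNy; subst; rewrite eqxx.
Qed.

Definition configuration (G : sgraph) (P : {fset 'rV[R]_d})
    (p : {ffun G -> P}) : {ffun G -> 'rV[R]_d} :=
  [ffun v => val (p v)].

Definition edge_length_vectors (N : dnorm R d) (G : sgraph)
    (P : {fset 'rV[R]_d}) : {fset {ffun edge G -> R}} :=
  [fset edge_lengths N (configuration p) | p in {: {ffun G -> P}}]%fset.

Lemma edge_length_vectorsP (N : dnorm R d) (G : sgraph) (P : {fset 'rV[R]_d})
    (l : {ffun edge G -> R}) :
  l \in edge_length_vectors N G P <->
  exists2 p : {ffun G -> 'rV[R]_d},
    (forall v, p v \in P) & l = edge_lengths N p.
Proof.
split=> [/imfsetP[/= p _ ->]|[p pP ->]].
  by exists (configuration p) => // v; rewrite ffunE; exact: valP.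
apply/imfsetP; exists [ffun v => [` pP v]%fset] => //=; congr edge_lengths.
by apply/ffunP => v; rewrite !ffunE.
Qed.

End edge_lengths.

Local Open Scope classical_set_scope.

Section hausdorff_distance.
Context {R : realType} {d : nat}.
Implicit Types (x y z : 'rV[R]_d) (A B C : set 'rV[R]_d).

(* The norm of the library on 'rV[R]_d is the maximum norm. *)
Definition enorm x : R := Num.sqrt (\sum_i x ord0 i ^+ 2).

Definition edist x y : R := enorm (x - y).

(* The real-valued inf and sup are the genuine ones for nonempty bounded sets;
   unit balls are such, see unit_ball_neq0 and unit_ball_bounded. *)
Definition edist_set x A : R := inf [set edist x a | a in A].

Definition hausdorff_dist A B : R :=
  Num.max (sup [set edist_set a B | a in A]) (sup [set edist_set b A | b in B]).

Let sq x : R := \sum_i x ord0 i ^+ 2.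
Let dot x y : R := \sum_i x ord0 i * y ord0 i.

Let sqn_ge0 x : 0 <= sq x.
Proof. by apply: sumr_ge0 => i _; exact: sqr_ge0. Qed.

Lemma enorm_ge0 x : 0 <= enorm x.
Proof. exact: sqrtr_ge0. Qed.

Let sqr_enorm x : enorm x ^+ 2 = sq x.
Proof. by rewrite sqr_sqrtr; [|exact: sqn_ge0]. Qed.

Lemma enormN x : enorm (- x) = enorm x.
Proof. by congr Num.sqrt; apply: eq_bigr => i _; rewrite mxE sqrrN. Qed.

Lemma enorm0 : enorm 0 = 0.
Proof.
by rewrite /enorm big1 ?sqrtr0// => i _; rewrite mxE expr0n.
Qed.

Let sqD (a b : R) x y :
  sq (a *: x + b *: y) = a ^+ 2 * sq x + (a * b) *+ 2 * dot x y + b ^+ 2 * sq y.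
Proof.
rewrite /sq /dot !mulr_sumr -!big_split /=; apply: eq_bigr => i _.
by rewrite !mxE; ring.
Qed.

Let dot_le x y : dot x y <= enorm x * enorm y.
Proof.
have [x0|xN0] := eqVneq (enorm x) 0.
  have sx0 i : x ord0 i = 0.
    apply/eqP; rewrite -sqrf_eq0; have := sqr_enorm x.
    rewrite x0 expr0n /= => /esym/eqP.
    rewrite psumr_eq0; last by move=> j _; exact: sqr_ge0.
    by move=> /allP/(_ i (mem_index_enum _)).
  by rewrite x0 mul0r /dot big1// => i _; rewrite sx0 mul0r.
have [y0|yN0] := eqVneq (enorm y) 0.
  have sy0 i : y ord0 i = 0.
    apply/eqP; rewrite -sqrf_eq0; have := sqr_enorm y.
    rewrite y0 expr0n /= => /esym/eqP.
    rewrite psumr_eq0; last by move=> j _; exact: sqr_ge0.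
    by move=> /allP/(_ i (mem_index_enum _)).
  by rewrite y0 mulr0 /dot big1// => i _; rewrite sy0 mulr0.
have ab0 : 0 < enorm x * enorm y.
  by rewrite mulr_gt0// lt_neqAle eq_sym ?xN0 ?yN0 enorm_ge0.
have := sqn_ge0 (enorm y *: x + (- enorm x) *: y).
rewrite sqD -!sqr_enorm => h.
have -> : dot x y = (enorm x * enorm y)^-1 * (enorm x * enorm y * dot x y).
  by rewrite mulrA mulVf ?mul1r// gt_eqF.
rewrite mulrC ler_pdivrMr//.
move: h; set a := enorm x; set b := enorm y; set t := dot x y => h.
rewrite -(ler_pM2l (x := 2%:R))// -subr_ge0.
by apply: le_trans h _; rewrite le_eqVlt; apply/orP; left; apply/eqP; ring.
Qed.

Lemma enormD x y : enorm (x + y) <= enorm x + enorm y.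
Proof.
rewrite -(ler_pXn2r (n := 2))// ?nnegrE ?addr_ge0 ?enorm_ge0//.
have -> : enorm (x + y) ^+ 2 = sq (1 *: x + 1 *: y).
  by rewrite !scale1r sqr_enorm.
rewrite sqD sqrrD -!sqr_enorm !expr1n !mul1r lerD2r lerD2l.
by rewrite mulr_natl lerMn2r dot_le orbT.
Qed.

Lemma edist_ge0 x y : 0 <= edist x y.
Proof. exact: enorm_ge0. Qed.

Lemma edist_sym x y : edist x y = edist y x.
Proof. by rewrite /edist -enormN opprB. Qed.

Lemma edistxx x : edist x x = 0.
Proof. by rewrite /edist subrr enorm0. Qed.

Lemma edist_triangle y x z : edist x z <= edist x y + edist y z.
Proof.
by rewrite /edist (le_trans _ (enormD _ _))// addrA subrK.
Qed.

Lemma coord_le_enorm x i : `|x ord0 i| <= enorm x.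
Proof.
rewrite -sqrtr_sqr ler_wsqrtr// (bigD1 i)//= lerDl.
by apply: sumr_ge0 => j _; exact: sqr_ge0.
Qed.

Lemma enorm_le_sum x : enorm x <= \sum_i `|x ord0 i|.
Proof.
have s0 : 0 <= \sum_i `|x ord0 i| by apply: sumr_ge0.
rewrite -(ler_pXn2r (n := 2))// ?nnegrE ?enorm_ge0// sqr_enorm /sq.
rewrite [leRHS]expr2 mulr_suml; apply: ler_sum => i _.
rewrite -normr_id -real_normK ?num_real// normr_id expr2 ler_wpM2l//.
by rewrite (bigD1 i)//= lerDl sumr_ge0.
Qed.

Definition ebounded A := exists M : R, forall x, A x -> enorm x <= M.

Let dset_lb x A : lbound [set edist x a | a in A] 0.
Proof. by move=> _ [a _ <-]; exact: edist_ge0. Qed.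

Lemma edist_set_le x A a : A a -> edist_set x A <= edist x a.
Proof. by move=> Aa; apply: ge_inf; [exists 0; exact: dset_lb|exists a]. Qed.

Lemma le_edist_set x A e : A !=set0 ->
  (forall a, A a -> e <= edist x a) -> e <= edist_set x A.
Proof.
move=> [a0 Aa0] h; apply: lb_le_inf; first by exists (edist x a0), a0.
by move=> _ [a Aa <-]; exact: h.
Qed.

Let sup_ub A B a : B !=set0 -> ebounded A -> A a ->
  edist_set a B <= sup [set edist_set a B | a in A].
Proof.
move=> [b Bb] [M AM] Aa; apply: sup_upper_bound; last by exists a.
split; first by exists (edist_set a B), a.
exists (M + enorm b) => _ [x Ax <-]; apply: le_trans (edist_set_le x Bb) _.
by rewrite /edist (le_trans (enormD _ _))// enormN lerD2r AM.
Qed.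

Lemma edist_set_le_hausdorff A B a : B !=set0 -> ebounded A -> A a ->
  edist_set a B <= hausdorff_dist A B.
Proof. by move=> B0 bA Aa; rewrite /hausdorff_dist le_max sup_ub. Qed.

Lemma hausdorff_dist_sym A B : hausdorff_dist A B = hausdorff_dist B A.
Proof. by rewrite /hausdorff_dist maxC. Qed.

Lemma hausdorff_dist_le A B e : A !=set0 -> B !=set0 ->
  (forall a, A a -> edist_set a B <= e) ->
  (forall b, B b -> edist_set b A <= e) -> hausdorff_dist A B <= e.
Proof.
move=> [a Aa] [b Bb] hA hB; rewrite /hausdorff_dist ge_max; apply/andP; split.
  apply: ge_sup; first by exists (edist_set a B), a.
  by move=> _ [x Ax <-]; exact: hA.
apply: ge_sup; first by exists (edist_set b A), b.
by move=> _ [x Ax <-]; exact: hB.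
Qed.

Let half_triangle A B C a : B !=set0 -> C !=set0 -> ebounded A -> ebounded B ->
  A a -> edist_set a C <= hausdorff_dist A B + hausdorff_dist B C.
Proof.
move=> B0 C0 bA bB Aa.
rewrite -lerBlDr; apply: le_trans (edist_set_le_hausdorff B0 bA Aa).
apply: le_edist_set => // b Bb; rewrite lerBlDr.
rewrite -lerBlDl; apply: le_trans (edist_set_le_hausdorff C0 bB Bb).
apply: le_edist_set => // c Cc; rewrite lerBlDl.
by apply: le_trans (edist_set_le a Cc) _; exact: edist_triangle.
Qed.

Lemma hausdorff_dist_triangle B A C :
  A !=set0 -> B !=set0 -> C !=set0 ->
  ebounded A -> ebounded B -> ebounded C ->
  hausdorff_dist A C <= hausdorff_dist A B + hausdorff_dist B C.
Proof.
move=> A0 B0 C0 bA bB bC; apply: hausdorff_dist_le => // x Xx.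
  exact: half_triangle.
rewrite addrC hausdorff_dist_sym (hausdorff_dist_sym A); exact: half_triangle.
Qed.

Lemma hausdorff_distxx A : A !=set0 -> ebounded A -> hausdorff_dist A A = 0.
Proof.
move=> [a Aa] bA; have A0 : A !=set0 by exists a.
apply/eqP; rewrite eq_le; apply/andP; split.
  by apply: hausdorff_dist_le => // x Ax; rewrite -(edistxx x) edist_set_le.
apply: le_trans (edist_set_le_hausdorff A0 bA Aa).
by apply: le_edist_set => // b _; exact: edist_ge0.
Qed.

End hausdorff_distance.

Section dnorm_metric.
Context {R : realType} {d : nat}.
Implicit Types (N : dnorm R d) (x y : 'rV[R]_d).

Definition unit_ball N : set 'rV[R]_d := [set x | N x <= 1].

Lemma unit_ball_neq0 N : unit_ball N !=set0.
Proof. by exists 0; rewrite /unit_ball /= dnorm0 ler01. Qed.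

Lemma dnorm_sum N (I : Type) (s : seq I) (F : I -> 'rV[R]_d) :
  N (\sum_(i <- s) F i) <= \sum_(i <- s) N (F i).
Proof.
elim/big_ind2 : _ => //; first by rewrite dnorm0.
move=> x a y b xa yb; exact: le_trans (dnorm_triangle _ _ _) (lerD xa yb).
Qed.

Lemma coord_le_norm x i : `|x ord0 i| <= `|x|.
Proof.
rewrite [leRHS]/Num.norm /= mx_normrE.
by apply/bigmax_geP; right => /=; exists (ord0, i).
Qed.

Lemma norm_le_enorm x : `|x| <= enorm x.
Proof.
rewrite [leLHS]/Num.norm /= mx_normrE; apply/bigmax_leP; split.
  exact: enorm_ge0.
by move=> [i j] _ /=; rewrite ord1 coord_le_enorm.
Qed.

Lemma enorm_le_norm x : enorm x <= d%:R * `|x|.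
Proof.
apply: le_trans (enorm_le_sum x) _.
have -> : d%:R * `|x| = \sum_(i < d) `|x|.
  by rewrite sumr_const card_ord mulr_natl.
by apply: ler_sum => i _; exact: coord_le_norm.
Qed.

Lemma dnorm_le_norm N : exists2 K : R, 0 < K & forall x, N x <= K * `|x|.
Proof.
have S0 : 0 <= \sum_i N (delta_mx ord0 i).
  by apply: sumr_ge0 => i _; exact: dnorm_ge0.
exists (1 + \sum_i N (delta_mx ord0 i)); first by rewrite ltr_pwDl.
move=> x; rewrite mulrDl mul1r.
rewrite (@le_trans _ _ (\sum_i N (delta_mx ord0 i) * `|x|))//.
  rewrite {1}(row_sum_delta x); apply: le_trans (dnorm_sum _ _ _) _.
  apply: ler_sum => i _.
  by rewrite dnormZ mulrC ler_wpM2l ?dnorm_ge0// coord_le_norm.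
by rewrite mulr_suml lerDr.
Qed.

Lemma ler_dnormB N x y : N x - N y <= N (x - y).
Proof.
by rewrite lerBlDr (le_trans _ (dnorm_triangle _ _ _))// subrK.
Qed.

Lemma dnorm_continuous N : continuous (N : 'rV[R]_d -> R).
Proof.
have [K K0 NK] := dnorm_le_norm N.
move=> x; apply/(@cvgrPdist_le _ _ _ (nbhs x) (nbhs_filter x)) => e e0.
have eK : 0 < e / K by rewrite divr_gt0.
apply/nbhs_ballP; exists (e / K) => //= y; rewrite mx_norm_ball /= => xy.
have xye : N (x - y) <= e.
  by apply: le_trans (NK _) _; rewrite mulrC -ler_pdivlMr// ltW.
rewrite ler_norml lerNl opprB !(le_trans (ler_dnormB _ _ _))//.
by rewrite dnormB.
Qed.

Lemma norm_le_dnorm N : exists2 K : R, 0 < K & forall x, `|x| <= K * N x.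
Proof.
pose S := [set x : 'rV[R]_d | `|x| = 1].
have [S0|S0] := pselect (S !=set0); last first.
  exists 1 => // x; have [->|xN0] := eqVneq x 0.
    by rewrite normr0 dnorm0 mulr0.
  exfalso; apply: S0; exists (`|x|^-1 *: x).
  by rewrite /S /= normrZ normfV normr_id mulVf ?normr_eq0.
have cS : compact S.
  apply: bounded_closed_compact.
    by exists 1; split => // M M1 x /= ->; exact: ltW.
  have -> : S = (fun x : 'rV[R]_d => `|x|) @^-1` [set 1] by [].
  by apply: preimage_closed => [x _|]; [exact: norm_continuous|exact: closed_eq].
have cN : {within S, continuous (N : 'rV[R]_d -> R)}.
  exact/continuous_subspaceT/dnorm_continuous.
have [c /set_mem Sc cmin] := compact_EVT_min S0 cS cN.
have Nc0 : 0 < N c.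
  rewrite lt_neqAle dnorm_ge0 andbT eq_sym; apply/negP => /eqP/dnorm_eq0 c0.
  by move: Sc; rewrite /S /= c0 normr0 => /esym/eqP; rewrite oner_eq0.
exists (N c)^-1; first by rewrite invr_gt0.
move=> x; have [->|xN0] := eqVneq x 0; first by rewrite normr0 dnorm0 mulr0.
have nx0 : 0 < `|x| by rewrite normr_gt0.
rewrite mulrC ler_pdivlMr// mulrC -ler_pdivlMr// mulrC.
rewrite -[X in X * N x]ger0_norm ?invr_ge0// -dnormZ.
apply: cmin; apply/mem_set.
by rewrite /S /= normrZ normfV normr_id mulVf ?normr_eq0.
Qed.

Lemma unit_ball_bounded N : ebounded (unit_ball N).
Proof.
have [K K0 NK] := norm_le_dnorm N.
exists (d%:R * K) => x Nx; apply: le_trans (enorm_le_norm x) _.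
rewrite ler_wpM2l//; apply: le_trans (NK x) _.
by rewrite -[leRHS]mulr1 ler_wpM2l// ltW.
Qed.

Lemma edist_set_unit_ball0 N x : edist_set x (unit_ball N) = 0 -> N x <= 1.
Proof.
have [K K0 NK] := dnorm_le_norm N => x0.
apply/ler_addgt0Pr => e e0; rewrite leNgt; apply/negP => Nx.
suff : e / K <= edist_set x (unit_ball N) by rewrite x0 leNgt divr_gt0.
apply: le_edist_set; first exact: unit_ball_neq0.
move=> y Ny; rewrite ler_pdivrMr// mulrC.
apply: le_trans (_ : K * `|x - y| <= _); last first.
  by rewrite ler_wpM2l ?norm_le_enorm// ltW.
apply: le_trans (NK _); apply: le_trans (ler_dnormB _ _ _).
by rewrite lerBrDr (le_trans _ (ltW Nx))// addrC lerD2r.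
Qed.

Lemma unit_ball_le N N' : unit_ball N `<=` unit_ball N' -> forall x, N' x <= N x.
Proof.
move=> sub x; have [Nx0|Nx0] := eqVneq (N x) 0.
  by rewrite (dnorm_eq0 Nx0) !dnorm0.
have Nx : 0 < N x by rewrite lt_neqAle eq_sym Nx0 dnorm_ge0.
have := sub ((N x)^-1 *: x); rewrite /unit_ball /= !dnormZ.
rewrite ger0_norm ?invr_ge0 ?dnorm_ge0// mulVf// => /(_ (lexx _)).
by rewrite mulrC ler_pdivrMr// mul1r.
Qed.

Lemma dnormP N N' : (forall x, N x = N' x) -> N = N'.
Proof.
case: N N' => [f fD fZ f0] [g gD gZ g0] /= /funext fg.
by subst g; congr DNorm; exact: Prop_irrelevance.
Qed.

Definition dnorm_dist N N' : R := hausdorff_dist (unit_ball N) (unit_ball N').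

Lemma dnorm_distxx N : dnorm_dist N N = 0.
Proof. exact: hausdorff_distxx (unit_ball_neq0 N) (unit_ball_bounded N). Qed.

Lemma dnorm_dist_sym N N' : dnorm_dist N N' = dnorm_dist N' N.
Proof. exact: hausdorff_dist_sym. Qed.

Lemma dnorm_dist_triangle N' N N'' :
  dnorm_dist N N'' <= dnorm_dist N N' + dnorm_dist N' N''.
Proof.
by apply: hausdorff_dist_triangle;
  (exact: unit_ball_neq0 || exact: unit_ball_bounded).
Qed.

Let dnorm_dist_eq0_le N N' : dnorm_dist N N' = 0 -> forall x, N' x <= N x.
Proof.
move=> NN'0; apply: unit_ball_le => x Nx; apply: edist_set_unit_ball0.
apply/eqP; rewrite eq_le; apply/andP; split.
  rewrite -NN'0; apply: edist_set_le_hausdorff => //.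
    exact: unit_ball_neq0.
  exact: unit_ball_bounded.
by apply: le_edist_set (unit_ball_neq0 _) _ => y _; exact: edist_ge0.
Qed.

Lemma dnorm_dist_eq0 N N' : dnorm_dist N N' = 0 -> N = N'.
Proof.
move=> NN'0; apply: dnormP => x; apply/eqP; rewrite eq_le.
by rewrite !dnorm_dist_eq0_le// dnorm_dist_sym.
Qed.

HB.instance Definition _ := gen_eqMixin (dnorm R d).
HB.instance Definition _ := gen_choiceMixin (dnorm R d).
HB.instance Definition _ := isMetric.Build R (dnorm R d)
  dnorm_distxx dnorm_dist_eq0 dnorm_dist_sym dnorm_dist_triangle.

End dnorm_metric.

Section meagre.
Context {T : topologicalType}.

Definition nowhere_dense (A : set T) := (closure A)° = set0.

Definition meagre (A : set T) := exists2 F : (set T)^nat,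
  (forall n, nowhere_dense (F n)) & A `<=` \bigcup_n F n.

Definition most (P : T -> Prop) :=
  exists2 A : set T, meagre A & forall x, ~ A x -> P x.

End meagre.

(* Main.v *)
Require Import Defs.
From mathcomp Require Import all_boot all_order all_algebra finmap.
From mathcomp Require Import all_classical all_reals all_analysis.
From mathcomp Require Import ring lra zify.

(* Call a norm generic if the Q-span of r vectors contains at most 2dr vectors
   of any given length t > 0.  Most norms are generic: for k = dr + 1, fixing
   rational coefficients and a small rational box for k pairwise non-parallel
   unit vectors, one can perturb the norm near these k vectors independently;
   the k equations saying that they have length 1 cannot be solved by the dr
   coordinates of the r spanning vectors for all the L^k perturbations on a grid
   at once, by the pigeonhole principle, so each of these countably many bad
   sets of norms is nowhere dense.

   For a generic norm, weigh each vector u of length t by the number of p with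
   p and p + u in S.  A greedy Q-free family of such vectors carries at least
   1/(2d) of the total weight, and the translates by a Q-free family span at
   most n log n pairs of n points, as in a grid.  Hence every n points span
   O(n log n) pairs at distance t.  Summing over t, restricted each time to the
   points where t occurs, some point of S sees at least |S|/O(log n) distances
   in S; so all but O(K log n) points of S see at least K distances in S.
   Iterating, one gets sets S_m, ..., S_0 = P with m = |V| - 1 and each point
   of S_(i+1) seeing K = c n / log n distances in S_i.  Adding the vertices of
   the graph one at a time, each adjacent to an earlier one, there are K choices
   of a new length at each step. *)

Set Implicit Arguments.
Unset Strict Implicit.
Unset Printing Implicit Defensive.

Import Order.TTheory GRing.Theory Num.Theory Defs.

Local Open Scope ring_scope.

(** * Seminorms as perturbations of a norm *)

Section seminorm.
Context {R : realType} {d : nat}.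
Implicit Types (f g : 'rV[R]_d -> R) (x y : 'rV[R]_d) (N : dnorm R d).

Definition seminorm f :=
  (forall x y, f (x + y) <= f x + f y) /\
  (forall a x, f (a *: x) = `|a| * f x).

Lemma dnorm_seminorm N : seminorm N.
Proof. by split=> [x y|a x]; [exact: dnorm_triangle|exact: dnormZ]. Qed.

Lemma seminormD f g : seminorm f -> seminorm g -> seminorm (fun x => f x + g x).
Proof.
move=> [fD fZ] [gD gZ]; split=> [x y|a x]; last by rewrite fZ gZ mulrDr.
by rewrite addrACA lerD.
Qed.

Lemma seminormZ (c : R) f : 0 <= c -> seminorm f -> seminorm (fun x => c * f x).
Proof.
move=> c0 [fD fZ]; split=> [x y|a x]; last by rewrite fZ mulrCA.
by rewrite -mulrDr ler_wpM2l.
Qed.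

Lemma seminorm_max f g :
  seminorm f -> seminorm g -> seminorm (fun x => Num.max (f x) (g x)).
Proof.
move=> [fD fZ] [gD gZ]; split=> [x y|a x]; last by rewrite fZ gZ maxr_pMr.
rewrite ge_max; apply/andP; split.
  by apply: le_trans (fD x y) _; rewrite lerD// le_max lexx.
by apply: le_trans (gD x y) _; rewrite lerD// le_max lexx orbT.
Qed.

Lemma seminorm_sum (I : finType) (F : I -> 'rV[R]_d -> R) :
  (forall i, seminorm (F i)) -> seminorm (fun x => \sum_i F i x).
Proof.
move=> F_; split=> [x y|a x].
  by rewrite -big_split; apply: ler_sum => i _; exact: (F_ i).1.
by rewrite mulr_sumr; apply: eq_bigr => i _; exact: (F_ i).2.
Qed.

Lemma seminorm_ge0 f x : seminorm f -> 0 <= f x.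
Proof.
move=> [fD fZ]; have := fD x (-1 *: x).
rewrite fZ normrN1 mul1r scaleN1r subrr -(scale0r 0) fZ normr0 mul0r.
by rewrite -mulr2n pmulrn_lge0.
Qed.

Lemma dnorm_plus N g : seminorm g -> exists N', forall x, N' x = N x + g x.
Proof.
move=> sg; have [NgD NgZ] := seminormD (dnorm_seminorm N) sg.
have Ng0 x : N x + g x = 0 -> x = 0.
  move=> Ng; apply: (@dnorm_eq0 _ _ N); apply/eqP; rewrite eq_le dnorm_ge0 andbT.
  by rewrite -Ng lerDl seminorm_ge0.
by exists (DNorm NgD NgZ Ng0).
Qed.

Lemma seminorm_le_norm g : seminorm g ->
  exists2 K : R, 0 < K & forall x, g x <= K * `|x|.
Proof.
(* Added to the maximum norm, a seminorm becomes a norm, and [dnorm_le_norm] applies. *)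
pose N := DNorm (@ler_normD _ 'rV[R]_d) (@normrZ _ 'rV[R]_d) (@normr0_eq0 _ 'rV[R]_d).
move=> /(dnorm_plus N)[N' N'E]; have [K K0 N'K] := dnorm_le_norm N'.
by exists K => // x; rewrite (le_trans _ (N'K x))// N'E lerDr dnorm_ge0.
Qed.

Lemma ler_seminormB f x y : seminorm f -> `|f x - f y| <= f (x - y).
Proof.
move=> [fD fZ]; rewrite ler_norml lerNl opprB; apply/andP; split.
  have -> : f (x - y) = f (y - x).
    by rewrite -(opprB y x) -scaleN1r fZ normrN1 mul1r.
  by rewrite lerBlDr (le_trans _ (fD _ _))// subrK.
by rewrite lerBlDr (le_trans _ (fD _ _))// subrK.
Qed.

Lemma norm_rV_le x (e : R) : 0 <= e ->
  (forall i, `|x ord0 i| <= e) -> `|x| <= e.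
Proof.
move=> e0 xe; rewrite [leLHS]/Num.norm /= mx_normrE; apply/bigmax_leP; split => //.
by move=> [i j] _ /=; rewrite ord1.
Qed.

End seminorm.

(** * Hausdorff distance of unit balls against pointwise comparison of norms *)

Section dnorm_metric.
Context {R : realType} {d : nat}.
Implicit Types (x y : 'rV[R]_d) (N : dnorm R d).

(** The unit ball of [N'] lies in that of [N]; conversely, scaling by 1 / (1 + h K) takes the unit
    ball of [N] into that of [N'] and moves its points by O(h). *)
Lemma dnorm_dist_lt N (e : R) : 0 < e -> exists2 h : R, 0 < h &
  forall N', (forall x, N x <= N' x <= N x + h * `|x|) -> dnorm_dist N N' < e.
Proof.
move=> e0; have [K K0 NK] := norm_le_dnorm N.
(* [d%:R] compares [enorm] with the maximum norm, one [K] bounds the vectors of the unit ball, the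
   other enters the bound on [1 - l]; adding 1 keeps [C] positive even if [d] is 0. *)
pose C := d%:R * K * K + 1.
have C0 : 0 < C by rewrite ltr_wpDl// !mulr_ge0// ltW.
exists (e / 2 / C); first by rewrite !divr_gt0.
set h := e / 2 / C; have h0 : 0 < h by rewrite !divr_gt0.
move=> N' N'N; apply: (@le_lt_trans _ _ (e / 2)); last by lra.
have e20 : 0 <= e / 2 by lra.
apply: hausdorff_dist_le; [exact: unit_ball_neq0|exact: unit_ball_neq0| |].
- move=> x Nx; pose l := (1 + h * K)^-1.
  have hK : 0 < h * K by rewrite mulr_gt0.
  have l0 : 0 < l by rewrite invr_gt0; lra.
  have l1 : l <= 1 by rewrite invf_le1; lra.
  have xK : `|x| <= K.
    by apply: le_trans (NK x) _; rewrite ger_pMr.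
  have N'x : N' x <= 1 + h * K.
    have /andP[_ /le_trans] := N'N x; apply; apply: lerD => //.
    by rewrite ler_wpM2l// ltW.
  apply: le_trans (@edist_set_le _ _ x _ (l *: x) _) _.
    by rewrite /unit_ball /= dnormZ (ger0_norm (ltW l0)) [leLHS]mulrC ler_pdivrMr ?mul1r//; lra.
  rewrite /edist -{1}(scale1r x) -scalerBl.
  apply: le_trans (enorm_le_norm _) _; rewrite normrZ ger0_norm; last by lra.
  have l1h : 1 - l <= h * K.
    rewrite lerBlDl -lerBlDr /l -[leRHS]div1r ler_pdivlMr; last by lra.
    have := sqr_ge0 (h * K); nra.
  have -> : e / 2 = h * C by rewrite /h divfK// gt_eqF.
  apply: (@le_trans _ _ (d%:R * (h * K * K))).
    by rewrite ler_wpM2l// ler_pM//; lra.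
  rewrite /C; have : h * (d%:R * K * K + 1) = d%:R * (h * K * K) + h by ring.
  by move=> ->; rewrite lerDl ltW.
- move=> x N'x; rewrite (le_trans _ e20)// -(edistxx x) edist_set_le//.
  by rewrite /unit_ball /=; have /andP[Nx _] := N'N x; exact: le_trans Nx N'x.
Qed.

Lemma edist_set_ltP x (A : set 'rV[R]_d) e : (A !=set0)%classic ->
  edist_set x A < e -> exists2 a, A a & edist x a < e.
Proof.
move=> [a0 Aa0] /inf_lt[|_ [a Aa <-] ae]; first by exists (edist x a0), a0.
by exists a.
Qed.

(** As [K] depends on [N] only, [N'] may be chosen after [h]. A point of either ball has a point of
    the other within [h], which gives N x <= 1 + K h at once. For the lower bound, the supremum [m]
    of [N'] on the unit ball of [N] satisfies m <= 1 + K h m, while 1 = N' x <= m N x. *)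
Lemma dnorm_dist_unit N : exists2 K : R, 0 < K &
  forall N' (h : R), dnorm_dist N N' < h -> forall x, N' x = 1 ->
    `|N x - 1| <= K * h.
Proof.
have [K K0 NK] := dnorm_le_norm N.
exists K => // N' h NN'h x N'x1.
have h0 : 0 < h.
  apply: le_lt_trans NN'h; apply: (@le_trans _ _ (edist_set 0 (unit_ball N'))).
    by apply: le_edist_set; [exact: unit_ball_neq0|move=> *; exact: edist_ge0].
  apply: edist_set_le_hausdorff; [exact: unit_ball_neq0|exact: unit_ball_bounded|].
  by rewrite /unit_ball /= dnorm0 ler01.
have upper y : N' y <= 1 -> N y <= 1 + K * h.
  move=> N'y.
  have /(edist_set_ltP (unit_ball_neq0 N))[a Na ya] : edist_set y (unit_ball N) < h.
    rewrite (le_lt_trans _ NN'h)// dnorm_dist_sym; apply: edist_set_le_hausdorff => //.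
      exact: unit_ball_neq0.
    exact: unit_ball_bounded.
  rewrite -(subrK a y) (le_trans (dnorm_triangle _ _ _))// addrC lerD//.
  rewrite (le_trans (NK _))// ler_wpM2l ?ltW// (le_lt_trans (norm_le_enorm _))//.
have Kh : 0 < K * h by rewrite mulr_gt0.
rewrite ler_norml; apply/andP; split; last by rewrite lerBlDl upper ?N'x1.
rewrite lerBrDl.
(* This [c] only shows that [m] below is finite; it does not enter the bound. *)
have [c c0 N'c] : exists2 c : R, 0 < c & forall y, N' y <= c * N y.
  have [c1 c10 N'c1] := dnorm_le_norm N'; have [c2 c20 Nc2] := norm_le_dnorm N.
  exists (c1 * c2); first by rewrite mulr_gt0.
  by move=> y; rewrite (le_trans (N'c1 y))// -mulrA ler_wpM2l// ltW.
pose B := [set N' y | y in unit_ball N]%classic.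
have supB : has_sup B.
  split; first by exists (N' 0), 0 => //; rewrite /unit_ball /= dnorm0 ler01.
  exists c => _ [y Ny <-]; apply: le_trans (N'c y) _.
  by rewrite -[leRHS]mulr1 ler_wpM2l// ltW.
pose m := sup B.
have N'm y : N' y <= m * N y.
  have [Ny0|Ny0] := eqVneq (N y) 0.
    by rewrite (dnorm_eq0 Ny0) !dnorm0 mulr0.
  have Ny : 0 < N y by rewrite lt_neqAle eq_sym Ny0 dnorm_ge0.
  rewrite -ler_pdivrMr//; apply: (sup_upper_bound supB).
  exists ((N y)^-1 *: y); last first.
    by rewrite dnormZ ger0_norm ?invr_ge0 ?dnorm_ge0// mulrC.
  by rewrite /unit_ball /= dnormZ ger0_norm ?invr_ge0 ?dnorm_ge0// mulVf.
have m0 : 0 <= m.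
  apply: sup_upper_bound => //; exists 0; last by rewrite dnorm0.
  by rewrite /unit_ball /= dnorm0 ler01.
have mle : m <= 1 + K * h * m.
  apply: ge_sup; first exact: supB.1.
  move=> _ [y Ny <-].
  have /(edist_set_ltP (unit_ball_neq0 N'))[a Na ya] : edist_set y (unit_ball N') < h.
    rewrite (le_lt_trans _ NN'h)//; apply: edist_set_le_hausdorff => //.
      exact: unit_ball_neq0.
    exact: unit_ball_bounded.
  rewrite -(subrK a y) (le_trans (dnorm_triangle _ _ _))// addrC lerD//.
  rewrite (le_trans (N'm _))// mulrC ler_wpM2r//.
  rewrite (le_trans (NK _))// ler_wpM2l ?ltW// (le_lt_trans (norm_le_enorm _))//.
have := N'm x; rewrite N'x1 => mNx.
have Nx0 := dnorm_ge0 N x.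
have [Kh1|Kh1] := lerP 1 (K * h); first by lra.
have : m * (1 - K * h) <= 1 by lra.
nra.
Qed.

End dnorm_metric.

(** * Nowhere dense sets of norms *)

(** The cube of possible entries is cut into (q L)^(r d) cells of side c / L, fewer than the L^k
    functions [s]. *)
Lemma grid_pigeonhole (R : realType) (r d k : nat) (M c : R) :
  (r * d < k)%N -> 0 <= M -> 0 < c ->
  exists2 L : nat, (0 < L)%N &
    forall Y : {ffun 'I_k -> 'I_L} -> 'M[R]_(r, d),
    (forall s i j, `|Y s i j| <= M) ->
    exists s s', s != s' /\ forall i j, `|Y s i j - Y s' i j| <= c / L%:R.
Proof.
move=> ndk M0 c0; pose q := (Num.truncn (2 * M / c)).+1.
have Mc0 : 0 <= 2 * M / c by rewrite divr_ge0 ?mulr_ge0// ltW.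
have qM : 2 * M / c < q%:R by have /andP[] := truncn_itv Mc0.
(* [L > q ^ (r * d)] gives (q L)^(r d) < L^(r d + 1) <= L^k. *)
pose L := (q ^ (r * d)).+1; exists L => // Y YM.
have L0 : 0 < L%:R :> R by rewrite ltr0n.
pose z s (ij : 'I_r * 'I_d) := (Y s ij.1 ij.2 + M) * L%:R / c.
have z0 s ij : 0 <= z s ij.
  by rewrite divr_ge0 ?mulr_ge0 ?(ltW c0)//; have := YM s ij.1 ij.2; rewrite ler_norml; lra.
have zq s ij : (Num.truncn (z s ij) < q * L)%N.
  rewrite truncn_lt_nat// natrM; apply: (@le_lt_trans _ _ (2 * M / c * L%:R)).
    rewrite /z mulrAC ler_pM2r// ler_pM2r ?invr_gt0//.
    by have := YM s ij.1 ij.2; rewrite ler_norml; lra.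
  by rewrite ltr_pM2r.
pose f s := [ffun ij => Ordinal (zq s ij)].
have /injectivePn[s [s' ss' fss']] : ~~ injectiveb f.
  apply/negP => /injectiveP/leq_card; rewrite !card_ffun card_prod !card_ord.
  apply/negP; rewrite -ltnNge expnMn.
  apply: (@leq_trans (L ^ (r * d).+1)); last by rewrite leq_exp2l// ltnS expn_gt0.
  by rewrite expnS ltn_pmul2r// expn_gt0.
exists s, s'; split => // i j.
move: fss' => /ffunP/(_ (i, j)); rewrite !ffunE => -[/= zz].
have := truncn_itv (z0 s (i, j)); have := truncn_itv (z0 s' (i, j)).
rewrite zz; set t := Num.truncn _ => /andP[t1 t2] /andP[t3 t4].
have : `|z s (i, j) - z s' (i, j)| <= 1.
  by rewrite ler_norml; move: t2 t4; rewrite -natr1; lra.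
have -> : z s (i, j) - z s' (i, j) = (Y s i j - Y s' i j) * (L%:R / c).
  by rewrite /z /=; ring.
rewrite normrM (ger0_norm (x := L%:R / c)) ?divr_ge0 ?(ltW c0)//.
by rewrite -ler_pdivlMr ?divr_gt0// div1r invf_div.
Qed.

Section box_norms.
Context {R : realType} {d : nat}.

(* Near the rows of [w], the difference [max (D i) (H i) - D i] is a bump at
   the [i]-th row which vanishes at the other rows. *)
Definition separated_box k (w : 'M[R]_(k, d)) (e : R) :=
  exists D H : 'I_k -> 'rV[R]_d -> R,
  [/\ forall i, seminorm (D i), forall i, seminorm (H i) &
    exists2 b : R, 0 < b & forall u : 'M[R]_(k, d),
      (forall i j, `|u i j - w i j| <= e) -> forall i,
      D i (row i u) + b <= H i (row i u) /\
      forall j, j != i -> H i (row j u) <= D i (row j u)].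

(** [M] bounds [Y] for the pigeonhole principle; the box around [w] allows one choice of bumps for
    all [Y]. *)
Definition box_norms r k (A : 'M[R]_(k, r)) (w : 'M[R]_(k, d)) (M e : R) :
    set (dnorm R d) :=
  [set N | exists Y : 'M[R]_(r, d),
    [/\ forall i j, `|Y i j| <= M,
        forall i j, `|(A *m Y) i j - w i j| <= e &
        forall i, N (row i (A *m Y)) = 1]]%classic.

(** If the closure contained a ball around [N0], each small perturbation [Ns s] would have a
    solution [Y s] up to [eta]. Take [s != s'] with close solutions and [i] with [s i != s' i]: at
    the [i]-th row the two norms differ by at least h b / L because of the bump, but by at most 3/4
    of this because both are near 1. *)
Lemma box_norms_nowhere_dense r k (A : 'M[R]_(k, r)) (w : 'M[R]_(k, d))
    (M e : R) :
  (r * d < k)%N -> separated_box w e -> nowhere_dense (box_norms A w M e).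
Proof.
move=> rdk [D [H [sD sH [b b0 bump]]]].
apply/seteqP; split => // N0 /nbhs_ballP[h0 /= h00 ballN0].
have [h1 h10 hN0] := dnorm_dist_lt N0 h00.
pose E i x := Num.max (D i x) (H i x).
have sE i : seminorm (E i) by exact: seminorm_max.
have sS : seminorm (fun x => \sum_i (D i x + E i x)).
  by apply: seminorm_sum => i; exact: seminormD.
have [K1 K10 SK1] := seminorm_le_norm sS.
pose h := h1 / K1; have hgt0 : 0 < h by rewrite divr_gt0.
(* The difference [E i - D i] need not be a seminorm, but convex combinations of [D i] and [E i]
   are. *)
pose g L (s : {ffun 'I_k -> 'I_L}) x := h *
  \sum_i ((1 - (s i)%:R / L%:R) * D i x + (s i)%:R / L%:R * E i x).
have sL L (s : {ffun 'I_k -> 'I_L}) i : 0 <= ((s i)%:R / L%:R : R) <= 1.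
  have L0 : (0 < L)%N by apply: leq_ltn_trans (ltn_ord (s i)).
  by rewrite divr_ge0//= ler_pdivrMr ?ltr0n// mul1r ler_nat ltnW.
have sg L s : seminorm (@g L s).
  apply: seminormZ (ltW hgt0) _; apply: seminorm_sum => i.
  have /andP[s0 s1] := sL L s i.
  by apply: seminormD; apply: seminormZ; rewrite // subr_ge0.
have gh L s x : @g L s x <= h1 * `|x|.
  have -> : h1 * `|x| = h * (K1 * `|x|) by rewrite /h; field; exact: lt0r_neq0.
  rewrite /g ler_pM2l//; apply: le_trans (SK1 x).
  apply: ler_sum => i _; have /andP[s0 s1] := sL L s i.
  have := seminorm_ge0 x (sD i); have := seminorm_ge0 x (sE i).
  by move=> E0 D0; apply: lerD; rewrite ler_piMl//; lra.
have [K2 K20 N0K2] := dnorm_le_norm N0.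
pose K := K2 + h1; have K0 : 0 < K by rewrite addr_gt0.
pose a := 1 + \sum_i \sum_j `|A i j|.
have a0 : 0 < a.
  by rewrite ltr_pwDl// sumr_ge0// => i _; rewrite sumr_ge0.
have aA (Z : 'M[R]_(r, d)) t : 0 <= t -> (forall i j, `|Z i j| <= t) ->
    forall i, `|row i (A *m Z)| <= a * t.
  move=> t0 Zt i; apply: norm_rV_le => [|j]; first by rewrite mulr_ge0// ltW.
  rewrite !mxE (le_trans (ler_norm_sum _ _ _))//.
  apply: (@le_trans _ _ (\sum_l `|A i l| * t)).
    by apply: ler_sum => l _; rewrite normrM ler_wpM2l.
  rewrite -mulr_suml ler_wpM2r// /a (bigD1 i)//= addrCA lerDl.
  by rewrite addr_ge0// sumr_ge0// => i' _; rewrite sumr_ge0.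
(* Moving [Y] by [c / L%:R] changes the norm of a row of [A *m Y] by at most h b / (4 L), a quarter
   of the gap; [eta] is another quarter and is used twice. *)
pose c := h * b / (4 * K * a).
have c0 : 0 < c by rewrite !(divr_gt0, mulr_gt0, ltr0n).
have [L L0 pigeon] := grid_pigeonhole rdk (normr_ge0 M) c0.
have LR0 : 0 < L%:R :> R by rewrite ltr0n.
pose eta := h * b / (4 * L%:R); have eta0 : 0 < eta by rewrite !(divr_gt0, mulr_gt0, ltr0n).
have /choice[Ns NsE] s := dnorm_plus N0 (sg L s).
have NsK s x : Ns s x <= K * `|x| by rewrite NsE mulrDl lerD.
have near_one s : exists Y : 'M[R]_(r, d),
    [/\ forall i j, `|Y i j| <= `|M|,
        forall i j, `|(A *m Y) i j - w i j| <= e &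
        forall i, `|Ns s (row i (A *m Y)) - 1| <= eta].
  have [Kd Kd0 NsKd] := dnorm_dist_unit (Ns s).
  have : closure (box_norms A w M e) (Ns s).
    apply: ballN0; rewrite ballEmdist /=; apply: hN0 => x.
    by rewrite NsE lerDl seminorm_ge0//= lerD2l gh.
  move=> /(_ (ball (Ns s) (eta / Kd)))[].
    by apply/nbhs_ballP; exists (eta / Kd) => //=; rewrite divr_gt0.
  move=> N [[Y [YM Yw NY]]]; rewrite ballEmdist /= => NsN.
  exists Y; split => // [i j|i]; first by rewrite (le_trans (YM i j))// ler_norm.
  by rewrite (le_trans (NsKd _ _ NsN _ (NY i)))// mulrC divfK// gt_eqF.
have /choice[Y YP] := near_one.
have [s [s' [ss' YY]]] : exists s s', s != s' /\
    forall i j, `|Y s i j - Y s' i j| <= c / L%:R.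
  by apply: pigeon => s i j; have [] := YP s.
have [i si] : exists i, s i != s' i.
  apply/existsP; rewrite -negb_forall; apply: contra ss' => /forallP ss'.
  by apply/eqP/ffunP => i; apply/eqP.
have [_ Yw Ys] := YP s; have [_ _ Ys'] := YP s'.
set u := row i (A *m Y s); set u' := row i (A *m Y s').
have upper : `|Ns s u - Ns s' u| <= 3 * (h * b / (4 * L%:R)).
  have uu' : `|Ns s' u' - Ns s' u| <= h * b / (4 * L%:R).
    apply: le_trans (ler_seminormB _ _ (dnorm_seminorm _)) _.
    rewrite dnormB (le_trans (NsK _ _))//.
    have -> : u - u' = row i (A *m (Y s - Y s')) by rewrite mulmxBr linearB.
    have -> : h * b / (4 * L%:R) = K * (a * (c / L%:R)).
      by rewrite /c; field; rewrite !lt0r_neq0.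
    rewrite ler_pM2l//; apply: aA => [|i' j]; first by rewrite divr_ge0// ltW.
    by rewrite !mxE.
  have := Ys i; have := Ys' i; rewrite -/u -/u' /eta.
  by move: uu'; rewrite !ler_norml; lra.
(* The bumps at the other rows vanish at [u], so their weights in [s] and [s'] do not matter. *)
have Es j : j != i -> E j u = D j u.
  by move=> ji; apply/max_idPl; have [_] := bump _ Yw j; apply; rewrite eq_sym.
have Ei : b <= E i u - D i u.
  by have [? _] := bump _ Yw i; rewrite lerBrDl le_max; apply/orP; right.
have : h * b / L%:R <= `|Ns s u - Ns s' u|.
  have -> : Ns s u - Ns s' u =
      h * ((s i)%:R / L%:R - (s' i)%:R / L%:R) * (E i u - D i u).
    rewrite !NsE /g (bigD1 i)//= [in X in _ - X](bigD1 i)//=.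
    set F := \sum_(_ | _) _; set F' := \sum_(_ | _) _.
    have -> : F = F' by apply: eq_bigr => j ji; rewrite Es//; ring.
    ring.
  rewrite 2!normrM (ger0_norm (ltW hgt0)) -mulrBl normrM.
  rewrite (ger0_norm (x := L%:R^-1)) ?invr_ge0//.
  rewrite (ger0_norm (x := E i u - D i u)) ?(le_trans (ltW b0))//.
  have ss1 : 1 <= `|(s i)%:R - (s' i)%:R| :> R.
    move: si; rewrite neq_ltn => /orP[] si.
      have : (s i).+1%:R <= (s' i)%:R :> R by rewrite ler_nat.
      by rewrite -natr1 ler_normr; move=> ?; apply/orP; right; lra.
    have : (s' i).+1%:R <= (s i)%:R :> R by rewrite ler_nat.
    by rewrite -natr1 ler_normr; move=> ?; apply/orP; left; lra.
  set t := `|_| in ss1 *; set v := E i u - D i u in Ei *.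
  have -> : h * (t / L%:R) * v = h / L%:R * (t * v) by ring.
  rewrite mulrAC ler_pM2l ?divr_gt0// (le_trans Ei)// ler_peMl//.
  exact: le_trans (ltW b0) Ei.
have hbL : 0 < h * b / L%:R by rewrite !(divr_gt0, mulr_gt0, ltr0n).
have : 3 * (h * b / (4 * L%:R)) = 3 / 4 * (h * b / L%:R).
  by field; rewrite lt0r_neq0.
by move: upper; lra.
Qed.

End box_norms.

(** * Most norms are generic *)

Section generic.
Context {R : realType} {d : nat}.
Implicit Types N : dnorm R d.

(** Project to the line through row [i] along a coordinate hyperplane: [H] is the absolute
    coordinate on the line, and [D] is a multiple of the distance from [x] to its projection, zero
    on the line and positive at the other rows. *)
Lemma bump_exists k (u : 'M[R]_(k, d)) i : row i u != 0 ->
  (forall j a, j != i -> row j u <> a *: row i u) ->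
  exists D H : 'rV[R]_d -> R, [/\ seminorm D, seminorm H,
    D (row i u) + 1 <= H (row i u) &
    forall j, j != i -> H (row j u) + 1 <= D (row j u)].
Proof.
move=> /rV0Pn[c uc] npar; set v := row i u in uc npar *.
pose h (x : 'rV[R]_d) := x ord0 c / v ord0 c.
have hD x y : h (x + y) = h x + h y by rewrite /h mxE mulrDl.
have hZ a x : h (a *: x) = a * h x by rewrite /h mxE mulrA.
have sH : seminorm (fun x => `|h x|).
  by split=> [x y|a x]; [rewrite hD ler_normD|rewrite hZ normrM].
pose D0 x := `|x - h x *: v|.
have sD0 : seminorm D0.
  split=> [x y|a x]; rewrite /D0.
    by rewrite hD scalerDl opprD addrACA ler_normD.
  by rewrite hZ -scalerA -scalerBr normrZ.
have D0gt0 j : j != i -> 0 < D0 (row j u).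
  move=> ji; rewrite normr_gt0 subr_eq0; apply/eqP; exact: npar.
(* A sum of nonnegative terms, hence at least the ratio needed at each row. *)
pose C := \sum_(j | j != i) (`|h (row j u)| + 1) / D0 (row j u).
have C0 : 0 <= C.
  by apply: sumr_ge0 => j ji; rewrite divr_ge0 ?addr_ge0// ltW// D0gt0.
exists (fun x => C * D0 x), (fun x => `|h x|); split => //.
- exact: seminormZ.
- have -> : h v = 1 by rewrite /h divff.
  by rewrite /D0 /h divff// scale1r subrr normr0 mulr0 add0r normr1.
- move=> j ji; rewrite -ler_pdivrMr ?D0gt0// /C (bigD1 j)//= lerDl.
  by apply: sumr_ge0 => l /andP[li _]; rewrite divr_ge0 ?addr_ge0// ltW// D0gt0.
Qed.

Lemma separated_box_exists k (u : 'M[R]_(k, d)) : (forall i, row i u != 0) ->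
  (forall i j a, j != i -> row j u <> a *: row i u) ->
  exists2 e : R, 0 < e & separated_box u e.
Proof.
move=> u0 npar.
have /choice[D /choice[H DH]] i := bump_exists (u0 i) (@npar i).
have sD i : seminorm (D i) by have [] := DH i.
have sH i : seminorm (H i) by have [] := DH i.
have sS : seminorm (fun x => \sum_i (D i x + H i x)).
  by apply: seminorm_sum => i; exact: seminormD.
have [K K0 SK] := seminorm_le_norm sS.
have DHK i x : D i x + H i x <= K * `|x|.
  rewrite (le_trans _ (SK x))// (bigD1 i)//= lerDl.
  by apply: sumr_ge0 => j _; rewrite addr_ge0// seminorm_ge0.
(* With this radius each [D i] and [H i] moves by at most 1/4, so at least 1/2 remains of the gaps
   of 1. *)
exists (4 * K)^-1; first by rewrite invr_gt0 mulr_gt0.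
exists D, H; split => //; exists (1 / 2); first by rewrite divr_gt0.
move=> u' u'u i.
have K'0 : 0 <= (4 * K)^-1 by rewrite invr_ge0 mulr_ge0// ltW.
have close j : `|D i (row j u') - D i (row j u)| <= 1 / 4 /\
    `|H i (row j u') - H i (row j u)| <= 1 / 4.
  have : K * `|row j u' - row j u| <= 1 / 4.
    have -> : 1 / 4 = K * (4 * K)^-1 by field; exact: lt0r_neq0.
    by rewrite ler_pM2l// norm_rV_le// => l; rewrite !mxE.
  have D0 := seminorm_ge0 (row j u' - row j u) (sD i).
  have H0 := seminorm_ge0 (row j u' - row j u) (sH i).
  have := DHK i (row j u' - row j u).
  by split; apply: le_trans (ler_seminormB _ _ _) _ => //; lra.
have [_ _ Di Hj] := DH i; split=> [|j ji].
  by have := close i; rewrite !ler_norml; lra.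
by have := close j; have := Hj j ji; rewrite !ler_norml; lra.
Qed.

Definition rat_span r (Y : 'M[R]_(r, d)) (u : 'rV[R]_d) :=
  exists c : 'rV[rat]_r, u = map_mx ratr c *m Y.

Definition generic N := forall r (Y : 'M[R]_(r, d)) (t : R) (s : seq 'rV[R]_d),
  0 < t -> uniq s -> (forall u, u \in s -> N u = t) ->
  (forall u, u \in s -> rat_span Y u) -> (size s <= 2 * (r * d))%N.

(** Parallel vectors of equal norm are equal or opposite, so a half free of opposite vectors is
    pairwise non-parallel. Hence the factor 2 in [generic]. *)
Lemma half_up_to_sign (s : seq 'rV[R]_d) : uniq s -> 0 \notin s ->
  exists h : seq 'rV[R]_d, [/\ uniq h, {subset h <= s},
    forall u v, u \in h -> v \in h -> u != - v & (size s <= 2 * size h)%N].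
Proof.
move=> us s0.
have [h [uh hs hN sh]] : exists h : seq 'rV[R]_d, [/\ uniq h, {subset h <= s},
    forall u v, u \in h -> v \in h -> u != - v &
    {subset s <= h ++ map -%R h}].
  elim: s us s0 => [|u s IH]; first by exists [::].
  rewrite inE negb_or eq_sym => /andP[us /IH{}IH] /andP[u0 /IH[h [uh hs hN sh]]].
  have [uh'|uh'] := boolP (- u \in h).
    exists h; split => // [v /hs|v]; first by rewrite inE orbC => ->.
    rewrite inE => /orP[/eqP ->|/sh//].
    by rewrite mem_cat -{2}(opprK u) map_f ?orbT.
  exists (u :: h); split => /=.
  - by rewrite uh andbT; apply: contra us => /hs.
  - by move=> v; rewrite !inE => /orP[->//|/hs ->]; rewrite orbT.
  - have uN : u != - u by rewrite -addr_eq0 -mulr2n -scaler_nat scaler_eq0 pnatr_eq0.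
    move=> v w; rewrite !inE => /orP[/eqP ->|vh] /orP[/eqP ->|wh] //.
    + by apply: contra uh' => /eqP ->; rewrite opprK.
    + by apply: contra uh' => /eqP <-.
    + exact: hN.
  - move=> v; rewrite inE => /orP[/eqP ->|/sh]; first by rewrite mem_head.
    by rewrite !(mem_cat, inE) => /orP[] ->; rewrite ?orbT.
exists h; split => //.
by have := uniq_leq_size us sh; rewrite size_cat size_map addnn mul2n.
Qed.

Lemma rat_mx_approx m n (u : 'M[R]_(m, n)) (e : R) : 0 < e ->
  exists w : 'M[rat]_(m, n), forall i j, `|u i j - ratr (w i j)| <= e.
Proof.
move=> e0.
have /choice[w wu] (ij : 'I_m * 'I_n) : exists q : rat, `|u ij.1 ij.2 - ratr q| <= e.
  have [|q] := @rat_in_itvoo R (u ij.1 ij.2 - e) (u ij.1 ij.2 + e); first by lra.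
  by rewrite in_itv /= => qu; exists q; rewrite ler_norml; lra.
by exists (\matrix_(i, j) w (i, j)) => i j; rewrite mxE; exact: (wu (i, j)).
Qed.

Lemma most_generic : most generic.
Proof.
(* A countable type: [r], rational coefficients, a rational centre, and a number [m] giving both the
   bound on [Y] and the radius 1 / (m + 1). *)
pose T := {r : nat & ('M[rat]_((r * d).+1, r) * 'M[rat]_((r * d).+1, d) * nat)%type}.
pose F' (x : T) : set (dnorm R d) :=
  let A := map_mx ratr (projT2 x).1.1 in let w := map_mx ratr (projT2 x).1.2 in
  let m := (projT2 x).2 in
  [set N | separated_box w m.+1%:R^-1 /\ box_norms A w m%:R m.+1%:R^-1 N]%classic.
pose F n := if (choice.unpickle n : option T) is Some x then F' x else classical_sets.set0.
exists (\bigcup_n F n)%classic.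
  exists F => // n; rewrite /F; case: (choice.unpickle n) => [[r [[A w] m]]|]; last first.
    by rewrite /nowhere_dense closure0 interior0.
  rewrite /F' /=; set w' := map_mx ratr w.
  have [sep|nsep] := pselect (separated_box w' m.+1%:R^-1 : Prop).
    have := @box_norms_nowhere_dense R d _ _ (map_mx ratr A) w' m%:R _ (ltnSn _) sep.
    by congr nowhere_dense; apply/seteqP; split=> N //= -[].
  rewrite (_ : [set _ | _]%classic = set0) ?/nowhere_dense ?closure0 ?interior0//.
  by apply/seteqP; split=> N //= -[].
move=> N NF r Y t s t0 us Ns sY; rewrite leqNgt; apply/negP => rds; apply: NF.
have s0 : 0 \notin s.
  by apply/negP => /Ns; rewrite dnorm0 => t00; rewrite -t00 ltxx in t0.
have [h [uh hs hN sh]] := half_up_to_sign us s0.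
have {rds sh} rdh : ((r * d).+1 <= size h)%N.
  by move: rds sh; move: (r * d)%N => q; lia.
set k := (r * d).+1 in rdh.
have ih (i : 'I_k) : (i < size h)%N by rewrite (leq_trans (ltn_ord i)).
pose hh (i : 'I_k) := nth 0 h i.
have hhh i : hh i \in h by rewrite mem_nth.
have /choice[c cE] i : rat_span Y (hh i) by apply: sY; exact: hs.
pose A : 'M[rat]_(k, r) := \matrix_(i, j) c i ord0 j.
pose Y' := t^-1 *: Y.
have rowA i : row i (map_mx ratr A *m Y') = t^-1 *: hh i.
  rewrite row_mul -scalemxAr cE; congr (_ *: (_ *m _)).
  by apply/rowP => j; rewrite !mxE.
set u := map_mx ratr A *m Y' in rowA.
have Nu i : N (row i u) = 1.
  rewrite rowA dnormZ ger0_norm ?invr_ge0 ?ltW// Ns ?hs// mulVf// gt_eqF//.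
have [e e0 [D [H [sD sH [b b0 bump]]]]] : exists2 e : R, 0 < e & separated_box u e.
  apply: separated_box_exists => [i|i j a ji uij].
    by apply/eqP => ui; have /eqP := Nu i; rewrite ui dnorm0 eq_sym oner_eq0.
  have a1 : `|a| = 1 by have := Nu j; rewrite uij dnormZ Nu mulr1.
  have hij : hh j = a *: hh i.
    move: uij; rewrite !rowA scalerA mulrC -scalerA.
    by move/scalerI; apply; rewrite invr_neq0// gt_eqF.
  have [a1'|a1'] : a = 1 \/ a = -1.
    by case: (ger0P a) a1 => [a0 ->|a0 <-]; [left|right; rewrite opprK].
    move: ji; rewrite -(inj_eq val_inj) -(nth_uniq 0 (ih j) (ih i) uh).
    by rewrite -/(hh j) -/(hh i) hij a1' scale1r eqxx.
  by have := hN _ _ (hhh j) (hhh i); rewrite hij a1' scaleN1r eqxx.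
(* The first term makes the radius at most [e / 2], the second bounds the entries of [Y']. *)
pose m := maxn (Num.truncn (2 / e)) (Num.truncn (\sum_i \sum_j `|Y' i j|)).+1.
have me : m.+1%:R^-1 <= e / 2.
  rewrite -(invf_div 2 e) lef_pV2 ?posrE ?divr_gt0//.
  have /truncn_itv/andP[_ /ltW te] : 0 <= 2 / e by rewrite divr_ge0// ltW.
  by apply: le_trans te _; rewrite ler_nat ltnS leq_maxl.
have m10 : 0 < m.+1%:R^-1 :> R by rewrite invr_gt0.
have [w wu] := rat_mx_approx u m10.
pose x : T := existT _ r (A, w, m).
exists (choice.pickle x) => //; rewrite /F choice.pickleK; split.
  (* The rational box around [w] lies within [e] of [u], where the bumps are known to work. *)
  exists D, H; split => //; exists b => // u' u'w; apply: bump => i j.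
  have {}u'w : `|u' i j - ratr (w i j)| <= m.+1%:R^-1.
    by have := u'w i j; rewrite [map_mx _ _ _ _]mxE.
  rewrite (le_trans (ler_distD (ratr (w i j)) _ _))// (splitr e) lerD//.
    exact: le_trans u'w me.
  by rewrite distrC (le_trans (wu i j)).
exists Y'; split => // [i j|i j]; last by rewrite [map_mx _ w _ _]mxE; exact: wu.
have SY0 : 0 <= \sum_i \sum_j `|Y' i j|.
  by apply: sumr_ge0 => ? _; apply: sumr_ge0.
have /andP[_ /ltW Ym] := truncn_itv SY0.
apply: (@le_trans _ _ (\sum_i \sum_j `|Y' i j|)).
  rewrite (bigD1 i)//= (bigD1 j)//= -addrA lerDl addr_ge0// sumr_ge0// => ? _.
  by rewrite sumr_ge0.
by apply: le_trans Ym _; rewrite ler_nat leq_maxr.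
Qed.

End generic.

(** * Pairs at a given distance *)

(** Since [a + b] is at least twice the smaller part, the logarithm gains 1 on each unit of that
    part. *)
Lemma trunc_log2_split (a b : nat) : (0 < a)%N -> (0 < b)%N ->
  (a * trunc_log 2 a + b * trunc_log 2 b + minn a b
   <= (a + b) * trunc_log 2 (a + b))%N.
Proof.
wlog ab : a b / (a <= b)%N => [hw a0 b0|a0 b0].
  have /orP[ab|ba] := leq_total a b; first exact: hw.
  by have := hw _ _ ba b0 a0; rewrite minnC [(b + a)%N]addnC [(_ * _ + _ * _)%N]addnC.
rewrite (minn_idPl ab) mulnDl addnAC leq_add//.
  rewrite -mulnSr leq_mul2l -trunc_log2_double// leq_trunc_log ?orbT//.
  by rewrite -addnn leq_add2l.
by rewrite leq_mul2l leq_trunc_log ?orbT// leq_addl.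
Qed.

Section unit_distances.
Context {R : realType} {d : nat}.
Implicit Types (N : dnorm R d) (S : seq 'rV[R]_d) (u p q : 'rV[R]_d).

Definition rat_free r (Y : 'M[R]_(r, d)) :=
  forall c : 'rV[rat]_r, map_mx ratr c *m Y = 0 -> c = 0.

Definition translate_count S u := count (fun p => p + u \in S) S.

(** As for edges in a grid, a hyperplane cuts [S] into nonempty parts [A] and [B]. Only translates
    in the direction [i0] cross it, at most min(|A|, |B|) of them; [trunc_log2_split] absorbs these
    in the induction on the size. *)
Lemma translate_count_grid r (Y : 'M[R]_(r, d)) S : rat_free Y -> uniq S ->
  (\sum_i translate_count S (row i Y) <= size S * trunc_log 2 (size S))%N.
Proof.
move=> freeY; have [n] := ubnP (size S); elim: n S => // n IH S Sn uS.
have [/existsP[i0 /hasP[p0 p0S p0y]]|] :=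
    boolP [exists i, has (fun p => p + row i Y \in S) S]; last first.
  rewrite negb_exists => /forallP noS; rewrite big1// => i _; apply/eqP.
  by rewrite /translate_count -leqn0 leqNgt -has_count noS.
(* The points of [p0] + the rational span whose coordinate [i0] is at most 0; all points off this
   coset go to the other side. *)
pose below p := exists c : 'rV[rat]_r,
  p = p0 + map_mx ratr c *m Y /\ c ord0 i0 <= 0.
have below_inj c c' : p0 + map_mx ratr c *m Y = p0 + map_mx ratr c' *m Y -> c = c'.
  move=> /addrI/eqP; rewrite -subr_eq0 -mulmxBl -map_mxB => /eqP/freeY/eqP.
  by rewrite subr_eq0 => /eqP.
have rowE i : row i Y = map_mx ratr (delta_mx ord0 i : 'rV[rat]_r) *m Y.
  by rewrite map_delta_mx rowE.
pose a p : bool := `[< below p >].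
have a0 : a p0.
  by apply/asboolP; exists 0; rewrite map_mx0 mul0mx addr0 mxE.
have aN0 : ~~ a (p0 + row i0 Y).
  apply/negP => /asboolP[c [] + c0]; rewrite rowE => /below_inj c1.
  by move: c0; rewrite -c1 mxE !eqxx lern0.
have aN i p : ~~ a p -> ~~ a (p + row i Y).
  apply: contra => /asboolP[c [pc c0]]; apply/asboolP.
  exists (c - delta_mx ord0 i); split; last first.
    by rewrite !mxE lerBlDr (le_trans c0)// add0r ler0n.
  by rewrite map_mxB mulmxBl -rowE addrA -pc addrK.
have aS i p : i != i0 -> a p -> a (p + row i Y).
  move=> ii0 /asboolP[c [pc c0]]; apply/asboolP.
  exists (c + delta_mx ord0 i); split.
    by rewrite map_mxD mulmxDl -rowE addrA -pc.
  by rewrite !mxE eqxx [i0 == i]eq_sym (negbTE ii0) addr0.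
pose A := [seq p <- S | a p]; pose B := [seq p <- S | ~~ a p].
have AB : (size A + size B = size S)%N by rewrite !size_filter -[RHS](count_predC a).
have A0 : (0 < size A)%N.
  by rewrite size_filter -has_count; apply/hasP; exists p0.
have B0 : (0 < size B)%N.
  by rewrite size_filter -has_count; apply/hasP; exists (p0 + row i0 Y).
have [uA uB] : uniq A /\ uniq B by rewrite !filter_uniq.
have split_le i : (translate_count S (row i Y) <= translate_count A (row i Y)
    + translate_count B (row i Y) + (i == i0) * minn (size A) (size B))%N.
  (* The pairs that cross the cut, counted by their ends in [A]; translation injects them into
     [B]. *)
  pose X := [seq p <- S | a p && ((p + row i Y \in S) && ~~ a (p + row i Y))].
  have XA : (size X <= size A)%N.
    by apply: uniq_leq_size; [exact: filter_uniq|move=> p; rewrite !mem_filter; case/andP=> /andP[-> _]].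
  have XB : (size X <= size B)%N.
    rewrite -(size_map (fun p => p + row i Y)); apply: uniq_leq_size.
      by rewrite map_inj_uniq ?filter_uniq//; exact: addIr.
    move=> _ /mapP[p + ->]; rewrite !mem_filter /=.
    by case/andP=> /andP[_ /andP[-> ->]].
  have : (translate_count S (row i Y) <= translate_count A (row i Y)
      + translate_count B (row i Y) + size X)%N.
    have countE (P : pred 'rV[R]_d) s : count P s = (\sum_(p <- s) P p)%N.
      by elim: s => [|p s IHs] /=; rewrite ?big_nil// big_cons IHs.
    rewrite /translate_count !count_filter size_filter !countE -!big_split /=.
    apply: leq_sum => p _; rewrite !mem_filter; have := aN i p.
    by case: (p + row i Y \in S); case: (a p); case: (a (p + row i Y)) => // /(_ isT).
  move=> /leq_trans; apply; rewrite leq_add2l.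
  have [ii0|ii0] := eqVneq i i0; first by rewrite mul1n leq_min XA.
  rewrite mul0n leqn0 size_filter -leqn0 leqNgt -has_count; apply/hasPn => p _.
  by have := aS i p ii0; case: (a p) => //= /(_ isT) ->; rewrite andbF.
apply: (@leq_trans (\sum_i (translate_count A (row i Y)
    + translate_count B (row i Y) + (i == i0) * minn (size A) (size B)))%N).
  by apply: leq_sum => i _; exact: split_le.
rewrite !big_split /= -big_distrl /=.
have -> : (\sum_i (i == i0) = 1)%N.
  by rewrite (bigD1 i0)//= eqxx big1// => i /negbTE ->.
rewrite mul1n -AB; apply: leq_trans (trunc_log2_split A0 B0).
by rewrite leq_add2r leq_add// IH//; lia.
Qed.

Lemma rat_span_col_mx r (Y : 'M[R]_(r, d)) u v :
  rat_span Y v -> rat_span (col_mx u Y) v.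
Proof.
move=> [c ->]; exists (row_mx 0 c).
by rewrite map_row_mx mul_row_col map_mx0 mul0mx add0r.
Qed.

Lemma rat_free_col_mx r (Y : 'M[R]_(r, d)) u :
  rat_free Y -> ~ rat_span Y u -> rat_free (col_mx u Y).
Proof.
move=> freeY uY c; rewrite -[c]hsubmxK map_row_mx mul_row_col.
set a := lsubmx c; set b := rsubmx c => ab0.
have [a0|a0] := eqVneq (a ord0 ord0) 0.
  have {}a0 : a = 0 by apply/rowP => i; rewrite ord1 a0 mxE.
  by move: ab0; rewrite a0 map_mx0 mul0mx add0r => /freeY ->; rewrite row_mx0.
case: uY; exists (- (a ord0 ord0)^-1 *: b).
move: ab0 => /eqP; rewrite addr_eq0 => /eqP au.
have {}au : ratr (a ord0 ord0) *: u = - (map_mx ratr b *m Y).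
  by rewrite -au [X in map_mx _ X *m _]mx11_scalar map_scalar_mx mul_scalar_mx.
rewrite map_mxZ -scalemxAl /= rmorphN fmorphV scaleNr -scalerN -au scalerA.
by rewrite mulVf ?scale1r// fmorph_eq0.
Qed.

(* [Y] is found greedily by decreasing weight; the free constant [c] makes the
   summation by parts an induction. *)
Lemma heavy_rat_basis N (t : R) (w : 'rV[R]_d -> nat) (s : seq 'rV[R]_d) :
  generic N -> 0 < t -> uniq s -> (forall u, u \in s -> N u = t) ->
  sorted (fun u v => w u <= w v)%N s ->
  exists r (Y : 'M[R]_(r, d)), [/\ rat_free Y,
    forall u, u \in s -> rat_span Y u &
    forall c, (forall u, u \in s -> c <= w u)%N ->
      (\sum_(u <- s) w u + 2 * (r * d) * c
       <= 2 * d * (\sum_i w (row i Y)) + size s * c)%N].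
Proof.
move=> genN t0; elim: s => [|u s IH] /= us Ns srt.
  exists 0, 0; split=> // [c _|c _]; first by apply/rowP => -[].
  by rewrite big_nil !(mul0n, muln0).
case/andP: us => us uniqs.
have [|||r [Y [freeY sY wY]]] := IH => //.
- by move=> v vs; apply: Ns; rewrite inE vs orbT.
- exact: path_sorted srt.
have uw v : v \in s -> (w u <= w v)%N.
  have /order_path_min : transitive (fun u v => w u <= w v)%N.
    by move=> ? ? ?; exact: leq_trans.
  by move=> /(_ _ _ srt)/seq.allP; apply.
(* The list ascends in weight, so [u] is lightest and [Y] comes from vectors at least as heavy. *)
have [uY|uY] := pselect (rat_span Y u).
  have sizes : ((size s).+1 <= 2 * (r * d))%N.
    apply: (genN _ Y t (u :: s)) => //=; first by rewrite us.
    by move=> v; rewrite inE => /orP[/eqP ->//|/sY].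
  exists r, Y; split => // [v|c cs]; first by rewrite inE => /orP[/eqP ->|/sY].
  have cu : (c <= w u)%N by rewrite cs ?mem_head.
  (* The induction hypothesis is used at the constant [w u]; since 2 r d is at least the length of
     [u :: s], the constant may be lowered to [c]. *)
  rewrite big_cons; have := wY _ uw.
  move: sizes; move: (\sum_(_ <- _) _)%N (2 * d * _)%N (2 * (r * d))%N => x y z.
  by move=> /= sz; nia.
exists (1 + r)%N, (col_mx u Y); split.
- exact: rat_free_col_mx.
- move=> v; rewrite inE => /orP[/eqP ->|/sY vY]; last exact: rat_span_col_mx.
  exists (row_mx 1%:M 0).
  by rewrite map_row_mx mul_row_col map_mx0 mul0mx addr0 map_mx1 mul1mx.
- move=> c cs; have cu : (c <= w u)%N by rewrite cs ?mem_head.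
  (* The new basis vector leaves the slack (2 d - 1) (w u - c), nonnegative once [d] is positive;
     genericity for the single vector [u] gives this. *)
  have d0 : (0 < d)%N.
    suff : (size [:: u] <= 2 * (1 * d))%N by rewrite mul1n muln_gt0.
    apply: (genN 1%N u t) => // v; rewrite inE => /eqP ->.
      by rewrite Ns ?mem_head.
    by exists 1%:M; rewrite map_mx1 mul1mx.
  rewrite big_cons big_split_ord /= big_ord1.
  have -> : row (lshift r ord0) (col_mx u Y) = u.
    by apply/rowP => j; rewrite mxE col_mxEu.
  have -> : (\sum_i w (row (rshift 1 i) (col_mx u Y)) = \sum_i w (row i Y))%N.
    apply: eq_bigr => i _; congr w; apply/rowP => j.
    by rewrite [LHS]mxE [RHS]mxE col_mxEd.
  have := wY c; move: (\sum_(_ <- _) _)%N (\sum_(_ < _) _)%N => x y h.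
  have {}h : (x + 2 * (r * d) * c <= 2 * d * y + size s * c)%N.
    by apply: h => v vs; apply: cs; rewrite inE vs orbT.
  by nia.
Qed.

(** Ordered pairs at distance [t] are counted by their difference [u], with weight
    [translate_count S u]; [heavy_rat_basis] at the constant 0 reduces the sum to a free family. *)
Lemma unit_distances_le N (t : R) S : generic N -> 0 < t -> uniq S ->
  (\sum_(p <- S) count (fun q => N (q - p)%R == t) S
   <= 2 * d * (size S * trunc_log 2 (size S)))%N.
Proof.
move=> genN t0 uS.
pose U0 := [seq u <- undup [seq q - p | q <- S, p <- S] | N u == t].
pose w := translate_count S.
pose U := sort (fun u v => w u <= w v)%N U0.
have [|u||r [Y [freeY _ /(_ 0%N)]]] := @heavy_rat_basis N t w U genN t0.
- by rewrite sort_uniq filter_uniq// undup_uniq.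
- by rewrite mem_sort mem_filter => /andP[/eqP].
- by apply: sort_sorted => u v; exact: leq_total.
rewrite !muln0 !addn0 => wY.
have {wY} wY : (\sum_(u <- U) w u <= 2 * d * (size S * trunc_log 2 (size S)))%N.
  apply: leq_trans (wY _) _ => //.
  by rewrite leq_mul2l translate_count_grid ?orbT.
have UU0 : perm_eq U U0 by rewrite perm_sort.
apply: leq_trans wY; rewrite (perm_big _ UU0) /=.
rewrite /w /translate_count.
under [leqRHS]eq_bigr do rewrite -sum1_count big_mkcond.
rewrite exchange_big /= big_seq [leqRHS]big_seq; apply: leq_sum => p pS.
rewrite -big_mkcond sum1_count -size_filter -[leqRHS]size_filter.
rewrite -(size_map (fun q => q - p)); apply: uniq_leq_size.
  by rewrite map_inj_uniq ?filter_uniq//; exact: addIr.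
move=> _ /mapP[q + ->]; rewrite !mem_filter => /andP[Nq qS].
rewrite addrC subrK qS Nq mem_undup /=.
by apply/allpairsP; exists (q, p).
Qed.

End unit_distances.

(** * Distances seen from one point *)

Section pinned_distances.
Context {R : realType} {d : nat}.
Implicit Types (N : dnorm R d) (S Q : seq 'rV[R]_d) (p q : 'rV[R]_d).

Definition distances_from N S p : seq R := undup [seq N (q - p) | q <- S].

(* If each distance [t] is realised at the points of [V t] only, then
   [|S|^2 = \sum_t e(t)] is at most of the order of
   [\sum_t |V t| log n = \sum_p |distances from p| log n]. *)
Lemma many_distances_from N S n : generic N -> uniq S -> (0 < size S <= n)%N ->
  exists2 p, p \in S &
    (size S <= (2 * d * trunc_log 2 n).+1 * size (distances_from N S p))%N.
Proof.
move=> genN uS /andP[S0 Sn]; set b := (2 * d * trunc_log 2 n).+1.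
have [/hasP[p pS pb]|/hasPn noS] :=
    boolP (has (fun p => size S <= b * size (distances_from N S p))%N S).
  by exists p.
(* If every point failed, summing over [S] would give |S|^2 + |S| <= |S|^2. *)
suff le : (size S * size S <= \sum_(p <- S) b * size (distances_from N S p))%N.
  have : (\sum_(p <- S) (b * size (distances_from N S p)).+1
      <= \sum_(p <- S) size S)%N.
    rewrite big_seq [leqRHS]big_seq; apply: leq_sum => p /noS.
    by rewrite -ltnNge.
  under eq_bigr do rewrite -add1n.
  rewrite big_split /= big_const_seq count_predT iter_addn_0 mul1n.
  rewrite big_const_seq count_predT iter_addn_0.
  by move: le; lia.
rewrite -big_distrr /=.
pose T := undup [seq N (q - p) | q <- S, p <- S].
pose V t := [seq p <- S | t \in distances_from N S p].
pose e t := (\sum_(p <- S) count (fun q => N (q - p)%R == t) S)%N.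
(* Both ends of a pair at distance [t] lie in [V t], so the bound on pairs can be applied to [V t]
   instead of [S]. *)
have le_e t : (e t <= b * size (V t))%N.
  pose e' := (\sum_(p <- V t) count (fun q => N (q - p)%R == t) (V t))%N.
  have -> : e t = e'.
    rewrite /e /e' big_filter [RHS]big_mkcond big_seq [RHS]big_seq.
    apply: eq_bigr => p pS; case: ifPn => [_|].
      rewrite count_filter; apply: eq_in_count => q qS /=.
      have [Nqp|//] := eqVneq; rewrite mem_undup; apply/esym/mapP.
      by exists p => //; rewrite -Nqp dnormB.
    rewrite mem_undup => tp; apply/eqP; rewrite -leqn0 leqNgt -has_count.
    by apply: contra tp => /hasP[q qS /eqP <-]; exact: map_f.
  have uV : uniq (V t) by exact: filter_uniq.
  have VS : (size (V t) <= size S)%N by rewrite size_filter count_size.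
  have [t0|t0] := ltrP 0 t.
    apply: leq_trans (unit_distances_le genN t0 uV) _.
    rewrite [(size _ * _)%N]mulnC mulnA leq_mul2r; apply/orP; right.
    by apply/leqW; rewrite leq_mul2l leq_trunc_log ?orbT// (leq_trans VS).
  (* For [t <= 0] only [q = p] can count; the successor in [b] covers this. *)
  apply: (@leq_trans (\sum_(p <- V t) 1)); last first.
    by rewrite sum1_size leq_pmull.
  apply: leq_sum => p _; apply: (@leq_trans (count (pred1 p) (V t))).
    apply: sub_count => q /= /eqP Nqp; apply/eqP.
    apply/eqP; rewrite -subr_eq0; apply/eqP/(@dnorm_eq0 _ _ N)/eqP.
    by rewrite eq_le dnorm_ge0 Nqp t0.
  by rewrite count_uniq_mem// leq_b1.
have -> : (size S * size S = \sum_(t <- T) e t)%N.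
  rewrite /e exchange_big /= -{1}sum1_size big_distrl /=.
  rewrite big_seq [RHS]big_seq; apply: eq_bigr => p pS.
  rewrite mul1n -sum1_size big_seq.
  transitivity (\sum_(t <- T) \sum_(q <- S | q \in S) (N (q - p)%R == t))%N.
    rewrite exchange_big /=; apply: eq_bigr => q qS.
    rewrite (bigD1_seq (N (q - p))) ?undup_uniq//=; last first.
      by rewrite mem_undup; apply/allpairsP; exists (q, p).
    by rewrite eqxx big1// => t; rewrite eq_sym => /negbTE ->.
  apply: eq_bigr => t _; rewrite -big_seq -sum1_count [RHS]big_mkcond.
  by apply: eq_bigr => q _; case: eqP.
apply: (@leq_trans (\sum_(t <- T) b * size (V t))%N); first exact: leq_sum.
rewrite -big_distrr /= leq_mul2l; apply/orP; right.
under eq_bigr do rewrite size_filter -sum1_count big_mkcond.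
rewrite exchange_big /=; apply: leq_sum => p _.
rewrite -big_mkcond sum1_count -size_filter uniq_leq_size//.
  by rewrite filter_uniq// undup_uniq.
by move=> t; rewrite mem_filter => /andP[].
Qed.

Definition rich_points N K S :=
  [seq p <- S | (K <= size (distances_from N S p))%N].

(** Apply [many_distances_from] to the set [B] of poor points: one of them sees at least |B| / b
    distances in [B], but fewer than [K] in [S]. *)
Lemma size_rich_points N K S n : generic N -> uniq S -> (size S <= n)%N ->
  (size S - (2 * d * trunc_log 2 n).+1 * K <= size (rich_points N K S))%N.
Proof.
move=> genN uS Sn; set b := (2 * d * trunc_log 2 n).+1.
pose B := [seq p <- S | ~~ (K <= size (distances_from N S p))%N].
have SB : (size (rich_points N K S) + size B = size S)%N.
  by rewrite !size_filter -[RHS](count_predC (fun p => K <= size (distances_from N S p))%N).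
suff Bb : (size B <= b * K)%N.
  by rewrite leq_subLR -SB [leqLHS]addnC leq_add2r.
have [->//|B0] := posnP (size B).
have uB : uniq B by exact: filter_uniq.
have [|p pB] := @many_distances_from N B n genN uB.
  by rewrite B0 (leq_trans _ Sn)// -SB leq_addl.
move=> /leq_trans; apply; rewrite leq_mul2l; apply/orP; right.
move: pB; rewrite mem_filter -ltnNge => /andP[/ltnW pK _].
apply: leq_trans pK; apply: uniq_leq_size; first exact: undup_uniq.
move=> t; rewrite !mem_undup => /mapP[q + ->]; rewrite mem_filter => /andP[_ qS].
exact: map_f.
Qed.

Lemma distinct_distances_points N S p K :
  (K <= size (distances_from N S p))%N -> exists Q,
  [/\ size Q = K, {subset Q <= S}, uniq Q &
    {in Q &, injective (fun q => N (q - p))}].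
Proof.
move=> KS.
have [Q [QS mQ]] : exists Q, {subset Q <= S} /\
    [seq N (q - p) | q <- Q] = distances_from N S p.
  rewrite /distances_from; elim: S {KS} => [|q S [Q [QS mQ]]] /=; first by exists [::].
  case: ifP => _; first by exists Q; split => // x /QS; rewrite inE orbC => ->.
  exists (q :: Q); split; last by rewrite /= mQ.
  by move=> x; rewrite !inE => /orP[->//|/QS ->]; rewrite orbT.
have uQ : uniq [seq N (q - p) | q <- Q] by rewrite mQ undup_uniq.
have sQ : (K <= size Q)%N by rewrite -(size_map (fun q => N (q - p))) mQ.
exists (take K Q); split.
- by rewrite size_takel.
- by move=> q /mem_take/QS.
- by rewrite take_uniq// (map_uniq uQ).
- move=> q q' /mem_take qQ /mem_take q'Q Nqq'.
  have := nth_uniq 0 _ _ uQ; rewrite size_map => /(_ (index q Q) (index q' Q)).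
  rewrite !index_mem !(nth_map 0) ?index_mem// !nth_index// Nqq' eqxx.
  move=> /(_ qQ q'Q)/esym/eqP qq'.
  by rewrite -(nth_index 0 qQ) qq' nth_index.
Qed.

End pinned_distances.

(** * Configurations of a connected graph *)

Lemma connected_boundary (G : sgraph) (W : {set G}) (w0 y : G) :
  connected_graph G -> w0 \in W -> y \notin W ->
  exists w x, [/\ w \in W, x \notin W & adj w x].
Proof.
move=> [_ connG] w0W yW; apply: contrapT => noedge.
have closedW : fingraph.closed (@adj G) W.
  have sub v w : adj v w -> v \in W -> w \in W.
    move=> vw vW; apply: contrapT => /negP wW; apply: noedge.
    by exists v, w.
  move=> v w vw; apply/idP/idP; first exact: sub vw.
  by apply: sub; rewrite adj_sym.
by move: yW; rewrite -(closed_connect closedW (connG w0 y)) w0W.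
Qed.

(** The sets [L i] are used from the last one back: a placed vertex lies in [L (#|G| - 1 - j)],
    hence sees [K] distances in the set one index lower, where the next vertex is put. *)
Lemma rigid_configurations (R : realType) (d : nat) (N : dnorm R d) (G : sgraph)
    (K : nat) (P : seq 'rV[R]_d) (p0 : 'rV[R]_d) (j : nat) :
  let L i := iter i (rich_points N K) P in
  connected_graph G -> (j < #|G|)%N -> p0 \in L (#|G| - 1)%N ->
  exists (W : {set G}) (C : seq {ffun G -> 'rV[R]_d}),
  [/\ #|W| = j.+1, uniq C & size C = (K ^ j)%N] /\
  [/\ forall p v, p \in C -> p v \in P,
      forall p w, p \in C -> w \in W -> p w \in L (#|G| - 1 - j)%N &
      {in C &, forall p p' : {ffun G -> 'rV[R]_d},
        (forall v w, v \in W -> w \in W -> adj v w ->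
          N (p v - p w) = N (p' v - p' w)) -> p = p'}].
Proof.
move=> L connG; have LP i : {subset L i <= P}.
  by elim: i => // i IH p; rewrite /= mem_filter => /andP[_ /IH].
elim: j => [|j IH] jG p0L.
  have [v0 _] := card_gt0P connG.1.
  (* Vertices not yet placed stay at the default value [p0]. *)
  exists [set v0]%SET, [:: [ffun=> p0]]; rewrite cards1 subn0; do 2!split => //.
  - by move=> p v; rewrite mem_seq1 => /eqP ->; rewrite ffunE (LP _ _ p0L).
  - by move=> p v; rewrite mem_seq1 => /eqP -> _; rewrite ffunE.
  - by move=> p p'; rewrite !mem_seq1 => /eqP -> /eqP ->.
have [W [C [[cW uC sC] [CP CL Cinj]]]] := IH (ltnW jG) p0L.
have [w0 w0W] : exists w0, w0 \in W by apply/card_gt0P; rewrite cW.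
have [y yW] : exists y, y \notin W.
  apply/existsP; rewrite -negb_forall; apply/negP => /forallP allW.
  have : (#|G| <= #|W|)%N by rewrite subset_leq_card//; apply/fintype.subsetP => v _.
  by rewrite cW leqNgt jG.
have [w [x [wW xW wx]]] := connected_boundary connG w0W yW.
set i := (#|G| - 1 - j.+1)%N.
have Li : L (#|G| - 1 - j)%N = rich_points N K (L i).
  by rewrite -[RHS]/(L i.+1) /i; congr (L _); lia.
have /choice[Q QP] (q : 'rV[R]_d) : exists Q, q \in L (#|G| - 1 - j)%N ->
    [/\ size Q = K, {subset Q <= L i}, uniq Q &
    {in Q &, injective (fun q' => N (q' - q))}].
  have [|] := boolP (q \in L (#|G| - 1 - j)%N); last by exists [::].
  by rewrite Li mem_filter => /andP[/distinct_distances_points[Q QP] _]; exists Q.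
pose upd (p : {ffun G -> 'rV[R]_d}) q := [ffun v => if v == x then q else p v].
have upd_x p q : upd p q x = q by rewrite ffunE eqxx.
have upd_W p q v : v \in W -> upd p q v = p v.
  by move=> vW; rewrite ffunE; case: eqP => // vx; move: xW; rewrite -vx vW.
(* Lengths inside [W] give back [p]; then the length of the edge from [x] to [w] gives back [q], as
   the points of [Q (p w)] have distinct distances from [p w]. *)
have upd_inj p q p' q' : p \in C -> p' \in C -> q \in Q (p w) -> q' \in Q (p' w) ->
    (forall v v', v \in x |: W -> v' \in x |: W -> adj v v' ->
      N (upd p q v - upd p q v') = N (upd p' q' v - upd p' q' v'))%SET ->
    p = p' /\ q = q'.
  move=> pC p'C qQ q'Q lengths.
  have pp' : p = p'.
    apply: Cinj => // v v' vW v'W vv'.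
    by have := lengths v v'; rewrite !upd_W//; apply=> //; rewrite !inE ?vW ?v'W orbT.
  split => //; subst p'; have [_ _ _ Qinj] := QP _ (CL _ _ pC wW).
  apply: Qinj => //; have := lengths x w.
  by rewrite !upd_x !upd_W//; apply; rewrite ?inE ?eqxx ?wW ?orbT// adj_sym.
exists (x |: W)%SET, [seq upd p q | p <- C, q <- Q (p w)]; split; split.
- by rewrite cardsU1 xW cW.
- apply: allpairs_uniq_dep => // [p pC|].
    by have [_ _ + _] := QP _ (CL _ _ pC wW).
  move=> _ _ /allpairsPdep[p [q [pC qQ ->]]] /allpairsPdep[p' [q' [p'C q'Q ->]]] /=.
  move=> e; have [|-> -> //] := upd_inj _ _ _ _ pC p'C qQ q'Q.
  by move=> v v' _ _ _; rewrite e.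
- rewrite size_allpairs_dep sumnE big_map (eq_big_seq (fun=> K)) => [|p pC].
    by rewrite big_const_seq count_predT iter_addn_0 sC expnS.
  by have [] := QP _ (CL _ _ pC wW).
- move=> _ v /allpairsPdep[p [q [pC qQ ->]]]; rewrite ffunE.
  case: eqP => [_|_]; last exact: CP.
  by have [_ QL _ _] := QP _ (CL _ _ pC wW); exact: LP (QL _ qQ).
- move=> _ v /allpairsPdep[p [q [pC qQ ->]]].
  have [_ QL _ _] := QP _ (CL _ _ pC wW).
  rewrite !inE => /orP[/eqP ->|vW]; first by rewrite upd_x QL.
  rewrite upd_W//; have := CL _ _ pC vW; rewrite Li mem_filter.
  by case/andP.
- move=> _ _ /allpairsPdep[p [q [pC qQ ->]]] /allpairsPdep[p' [q' [p'C q'Q ->]]] /=.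
  by move=> /(upd_inj _ _ _ _ pC p'C qQ q'Q)[-> ->].
Qed.

(** Each of the |G| - 1 passages to rich points loses at most b K points, so one survives; at the
    last stage [W] is the whole graph and the configurations have distinct length vectors. *)
Lemma edge_length_vectors_ge (R : realType) (d : nat) (N : dnorm R d)
    (G : sgraph) (P : {fset 'rV[R]_d}) (K : nat) :
  generic N -> connected_graph G ->
  (K * (2 * d * trunc_log 2 #|` P|).+1 * (#|G| - 1) < #|` P|)%N ->
  (K ^ (#|G| - 1) <= #|` edge_length_vectors N G P|)%N.
Proof.
move=> genN connG; have [G0 _] := connG; set b := (2 * d * _).+1 => KP.
pose L i := iter i (rich_points N K) (P : seq _).
have uL i : uniq (L i) by elim: i => [|i IH]; [exact: fset_uniq|exact: filter_uniq].
have sL i : (size (L i) <= #|` P|)%N.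
  by elim: i => // i; apply: leq_trans; rewrite size_filter count_size.
have Lsize i : (#|` P| - i * (b * K) <= size (L i))%N.
  elim: i => [|i IH]; first by rewrite mul0n subn0.
  apply: leq_trans (size_rich_points K genN (uL i) (sL i)).
  by rewrite mulSn addnC subnDA leq_sub2r.
have [p0 p0L] : exists p0, p0 \in L (#|G| - 1)%N.
  have : (0 < size (L (#|G| - 1)))%N.
    by apply: leq_trans (Lsize _); rewrite subn_gt0 mulnC [(b * K)%N]mulnC.
  by case: (L _) => // p0 s _; exists p0; exact: mem_head.
have [|W [C [[cW uC sC] [CP _ Cinj]]]] :=
    @rigid_configurations R d N G K P p0 (#|G| - 1)%N connG _ p0L.
  by rewrite subn1 ltn_predL.
have WT v : v \in W.
  have /eqP -> : W == [set: G]%SET; last by rewrite inE.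
  by rewrite eqEcard finset.subsetT /= cardsT cW subn1 prednK.
have uE : uniq [seq edge_lengths N p | p <- C].
  rewrite map_inj_in_uniq// => p p' pC p'C lengths; apply: Cinj => // v w _ _ vw.
  have vwE : [set v; w]%SET \in edge_set G by apply/finset.imset2P; exists v w.
  pose a : edge G := exist _ [set v; w]%SET vwE.
  by rewrite -!(@edge_lengthsE _ _ _ _ _ a)// lengths.
rewrite -sC -(size_map (@edge_lengths _ _ N G)); apply: uniq_leq_size uE _.
move=> _ /mapP[p pC ->]; apply/edge_length_vectorsP.
by exists p => // v; exact: CP.
Qed.

(** * Choice of the constants *)

(** The threshold gives l >= 2 a + 3, whence a l <= (l - 1) (l - 2) < 2^l <= n. *)
Lemma logarithmic_growth (a n : nat) : (2 ^ (2 * a).+3 <= n)%N ->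
  (0 < trunc_log 2 n)%N /\ (a * trunc_log 2 n <= n)%N.
Proof.
move=> an; set l := trunc_log 2 n.
have al : ((2 * a).+3 <= l)%N by rewrite /l trunc_log_max.
have n0 : (0 < n)%N by rewrite (leq_trans _ an)// expn_gt0.
split; first by move: al; lia.
apply: leq_trans (trunc_logP (p := 2) isT n0); rewrite -/l.
have pow2 k : (k * k.-1 < 2 ^ k.+1)%N.
  elim: k => // k IH; rewrite expnS mul2n -addnn /=.
  have kk : (k.+1 <= 2 ^ k)%N by rewrite ltn_expl.
  by move: IH kk; rewrite expnS; move: (2 ^ k)%N => x; nia.
have l0 : (0 < l)%N by move: al; lia.
have := pow2 l.-1; rewrite prednK//; move: al; move: (2 ^ l)%N => x; nia.
Qed.

Theorem theorem1p22 (R : realType) (d : nat) :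
  most (fun N : dnorm R d =>
    forall G : sgraph, connected_graph G ->
    exists2 c : R, 0 < c & exists n0 : nat,
    forall P : {fset 'rV[R]_d}, (n0 <= #|` P|)%N ->
      c * ((#|` P|)%:R / (ln (#|` P|)%:R) ^+ 2) ^+ (#|G| - 1)
        <= (#|` edge_length_vectors N G P|)%:R).
Proof.
have [A meagreA genA] := @most_generic R d.
exists A => // N /genA genN G connG.
(* [a] is such that [b * m.+1 <= a * l]; [m.+1] instead of [m] makes K b m < n strict and serves the
   one-vertex graph as well. *)
pose m := (#|G| - 1)%N; pose a := ((2 * d).+1 * m.+1)%N.
have ln2_gt0 : 0 < ln 2 :> R by rewrite ln_gt0 ?ltr1n.
have a0 : 0 < a%:R :> R by rewrite ltr0n muln_gt0.
(* From n <= 2 K a l and l ln 2 <= ln n. *)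
exists ((ln 2 ^+ 2 / (2 * a%:R)) ^+ m).
  by rewrite exprn_gt0 ?divr_gt0 ?exprn_gt0 ?mulr_gt0.
exists (2 ^ (2 * a).+3)%N => P nP; set n := #|` P| in nP *.
have [l0 al] := logarithmic_growth nP; set l := trunc_log 2 n in l0 al.
pose b := (2 * d * l).+1; pose K := (n %/ (b * m.+1))%N.
have b0 : (0 < b * m.+1)%N by [].
have n0 : (0 < n)%N by rewrite (leq_trans _ nP)// expn_gt0.
have bl : (b * m.+1 <= a * l)%N.
  rewrite /a mulnAC leq_mul2r mulSn orbC; apply/orP; left.
  by rewrite /b -add1n leq_add2r.
have K1 : (1 <= K)%N by rewrite divn_gt0// (leq_trans bl).
have Kb : (K * (b * m.+1) <= n)%N by exact: leq_trunc_div.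
have nK : (n <= 2 * K * (a * l))%N.
  have : (n < K.+1 * (b * m.+1))%N by exact: ltn_ceil.
  move=> /ltnW/leq_trans; apply; apply: leq_mul => //; lia.
have Klarge : (K ^ m <= #|` edge_length_vectors N G P|)%N.
  apply: edge_length_vectors_ge => //; apply: leq_trans Kb.
  by rewrite -/m -mulnA ltn_pmul2l// ltn_pmul2l.
apply: (@le_trans _ _ (K ^ m)%:R); last by rewrite ler_nat.
have lnn : l%:R * ln 2 <= ln n%:R :> R.
  rewrite mulrC mulr_natr -lnXn// -natrX ler_ln ?posrE ?ltr0n ?expn_gt0//.
  by rewrite ler_nat; exact: trunc_logP.
have l1 : 1 <= l%:R :> R by rewrite ler1n.
have lnn0 : 0 < ln n%:R :> R by apply: lt_le_trans lnn; rewrite mulr_gt0// ltr0n.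
rewrite natrX -exprMn; apply: lerXn2r; rewrite ?nnegrE ?ler0n//.
  by rewrite mulr_ge0 ?divr_ge0 ?exprn_ge0 ?mulr_ge0// ltW.
have -> : ln 2 ^+ 2 / (2 * a%:R) * (n%:R / ln n%:R ^+ 2) =
    n%:R * ln 2 ^+ 2 / (2 * a%:R * ln n%:R ^+ 2) :> R.
  by field; rewrite !lt0r_neq0.
rewrite ler_pdivrMr ?mulr_gt0 ?exprn_gt0//.
apply: (@le_trans _ _ ((2 * K * (a * l))%:R * ln 2 ^+ 2)).
  by rewrite ler_pM2r ?exprn_gt0// ler_nat.
have -> : (2 * K * (a * l))%:R * ln 2 ^+ 2 =
    K%:R * (2 * a%:R * (l%:R * ln 2 ^+ 2)) :> R by rewrite !natrM; ring.
rewrite ler_pM2l ?ltr0n// ler_pM2l ?mulr_gt0//.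
(* So far there is a single logarithm; [1 <= l] replaces [l] by its square. *)
apply: (@le_trans _ _ ((l%:R * ln 2) ^+ 2)).
  by rewrite exprMn ler_pM2r ?exprn_gt0// expr2 ler_peMl// (le_trans _ l1).
by rewrite lerXn2r ?nnegrE ?mulr_ge0// ltW.
Qed.
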